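(* Let $\Bbbk$ be an algebraically closed field and let $\mathcal A$ be any finite tensor category, or more generally any finite multi-tensor category, over $\Bbbk$. Then the 2-category of finite module categories over $\mathcal A$ is Krull--Schmidt, and so is its 2-subcategory of exact module categories.
   Context: A $\Bbbk$-linear category is finite if it is equivalent to the category of finite dimensional representations of some finite dimensional associative unital $\Bbbk$-algebra. A finite multi-tensor category (in the sense of Etingof--Ostrik) is a finite $\Bbbk$-linear category equipped with a rigid monoidal structure whose tensor product is $\Bbbk$-linear in both variables; it is a finite tensor category if moreover the unit object is simple (so that its endomorphism algebra is $\Bbbk$). A (left) module category over $\mathcal A$ is a $\Bbbk$-linear category $\mathcal M$ with a functor $\odot\colon\mathcal A\times\mathcal M\to\mathcal M$, $\Bbbk$-linear in both variables, and coherent natural associativity and unit isomorphisms; it is finite if $\mathcal M$ is finite as a $\Bbbk$-linear category. Finite module categories, ($\Bbbk$-linear, strong) module functors and module natural transformations form a 2-category. A module category $\mathcal M$ is exact if $P\odot M$ is projective in $\mathcal M$ for every $M\in\mathcal M$ and every projective $P\in\mathcal A$; exact module categories form a full 2-subcategory of the finite ones. A bicategory is locally additive if every Hom category is additive and every composition functor is additive in both variables. A direct sum of objects $X_1,\dots,X_n$ is an object $X$ with 1-cells $I_i\colon X_i\to X$, $P_i\colon X\to X_i$ such that there exist isomorphisms $P_iI_i\cong \mathrm{Id}_{X_i}$, $P_iI_j\cong 0$ for $i\neq j$, and $\bigoplus_i I_iP_i\cong \mathrm{Id}_X$; the empty direct sum is a zero object. A bicategory is additive if it is locally additive and admits all finite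 direct sums of objects. A nonzero object $X$ is strongly indecomposable if the commutative ring $\mathrm{End}(\mathrm{Id}_X)$ of 2-cells $\mathrm{Id}_X\Rightarrow\mathrm{Id}_X$ is connected (nonzero, with only idempotents $0,1$). An additive bicategory is Krull--Schmidt if every nonzero object is equivalent to a direct sum of finitely many strongly indecomposable objects. *)

(* Defs.v *)
(* Built on Mathematical Components, with the classical axioms of
   mathcomp.classical.boolp. *)
From HB Require Import structures.
From mathcomp Require Import all_boot all_order all_algebra.
From mathcomp Require Import boolp.

Set Implicit Arguments.
Unset Strict Implicit.
Unset Printing Implicit Defensive.

Import GRing.Theory.
Local Open Scope ring_scope.

Declare Scope cat_scope.
Delimit Scope cat_scope with cat.
Local Open Scope cat_scope.

Reserved Notation "g ∘ f" (at level 40, left associativity).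
Reserved Notation "X ⊗ Y" (at level 40, left associativity).
Reserved Notation "f ⊗₁ g" (at level 40, left associativity).
Reserved Notation "X ⊙ M" (at level 40, left associativity).
Reserved Notation "f ⊙₁ g" (at level 40, left associativity).
Reserved Notation "g ⊚ f" (at level 40, left associativity).
Reserved Notation "b ⊚₂ a" (at level 40, left associativity).

Record preaddCat := PreaddCat {
  ob :> Type;
  hom : ob -> ob -> Type;
  hom_zmod : forall x y, GRing.Zmodule (hom x y);
  idm : forall x, hom x x;
  mcomp : forall x y z, hom y z -> hom x y -> hom x z;
  mcomp1m : forall x y (f : hom x y), mcomp (idm y) f = f;
  mcompm1 : forall x y (f : hom x y), mcomp f (idm x) = f;
  mcompA : forall w x y z (h : hom y z) (g : hom x y) (f : hom w x),
    mcomp h (mcomp g f) = mcomp (mcomp h g) f;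
  mcompDl : forall x y z (f : hom x y) (g g' : GRing.Zmodule.Pack (hom_zmod y z)),
    mcomp (g + g') f
    = (mcomp g f : GRing.Zmodule.Pack (hom_zmod x z)) + mcomp g' f;
  mcompDr : forall x y z (g : hom y z) (f f' : GRing.Zmodule.Pack (hom_zmod x y)),
    mcomp g (f + f')
    = (mcomp g f : GRing.Zmodule.Pack (hom_zmod x z)) + mcomp g f'
}.
Arguments hom {p} x y.
Arguments idm {p} x.
Notation "g ∘ f" := (mcomp g f) : cat_scope.

HB.instance Definition _ (C : preaddCat) (x y : C) :=
  GRing.Zmodule.copy (@hom C x y) (GRing.Zmodule.Pack (@hom_zmod C x y)).

Record iso (C : preaddCat) (x y : C) := Iso {
  iso_hom :> hom x y;
  iso_inv : hom y x;
  iso_homK : iso_inv ∘ iso_hom = idm x;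
  iso_invK : iso_hom ∘ iso_inv = idm y
}.

Definition isomorphic (C : preaddCat) (x y : C) : Prop := inhabited (iso x y).

Definition id_iso (C : preaddCat) (x : C) : iso x x :=
  Iso (mcomp1m (idm x)) (mcomp1m (idm x)).

Section CompIso.
Variables (C : preaddCat) (x y z : C) (v : iso y z) (u : iso x y).

Fact comp_iso_homK : (iso_inv u ∘ iso_inv v) ∘ (v ∘ u) = idm x.
Proof.
by rewrite -mcompA [iso_inv v ∘ _]mcompA iso_homK mcomp1m iso_homK.
Qed.

Fact comp_iso_invK : (v ∘ u) ∘ (iso_inv u ∘ iso_inv v) = idm z.
Proof. by rewrite -mcompA [u ∘ (_ ∘ _)]mcompA iso_invK mcomp1m iso_invK. Qed.

Definition comp_iso : iso x z := Iso comp_iso_homK comp_iso_invK.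

End CompIso.

Definition is_zero (C : preaddCat) (z : C) : Prop :=
  forall x : C, (forall f : hom x z, f = 0) /\ (forall f : hom z x, f = 0).

(* [s] is a direct sum (biproduct) of the finite family [F]; for [n = 0] this
   says that [s] is a zero object. *)
Definition is_biproduct (C : preaddCat) (n : nat) (F : 'I_n -> C) (s : C) : Prop :=
  exists (i : forall j, hom (F j) s) (p : forall j, hom s (F j)),
    [/\ forall j, p j ∘ i j = idm (F j),
        forall j l, j != l -> p j ∘ i l = 0
      & \sum_j (i j ∘ p j) = idm s].

Definition additive_cat (C : preaddCat) : Prop :=
  forall (n : nat) (F : 'I_n -> C), exists s, is_biproduct F s.

Definition epi (C : preaddCat) (x y : C) (e : hom x y) : Prop :=
  forall (z : C) (g h : hom y z), g ∘ e = h ∘ e -> g = h.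

Definition projective (C : preaddCat) (p : C) : Prop :=
  forall (x y : C) (e : hom x y), epi e ->
  forall f : hom p y, exists g : hom p x, e ∘ g = f.

(* The mixin [GRing.Nmodule_isLSemiModule] supplies exactly what turns the
   abelian group [hom x y] into an [lmodType k]. *)
Record linCat (k : fieldType) := LinCat {
  lin_cat :> preaddCat;
  lin_scale : forall x y : lin_cat, GRing.Nmodule_isLSemiModule k (hom x y);
  mcompZl : forall (x y z : lin_cat) (a : k) (g : hom y z) (f : hom x y),
    GRing.Nmodule_isLSemiModule.scale (lin_scale y z) a g ∘ f
    = GRing.Nmodule_isLSemiModule.scale (lin_scale x z) a (g ∘ f);
  mcompZr : forall (x y z : lin_cat) (a : k) (g : hom y z) (f : hom x y),
    g ∘ GRing.Nmodule_isLSemiModule.scale (lin_scale x y) a f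
    = GRing.Nmodule_isLSemiModule.scale (lin_scale x z) a (g ∘ f)
}.

HB.instance Definition _ (k : fieldType) (C : linCat k) (x y : C) :=
  @lin_scale k C x y.

Record linFun (k : fieldType) (C D : linCat k) := LinFun {
  fob :> C -> D;
  fmap : forall x y : C, hom x y -> hom (fob x) (fob y);
  fmap_lin : forall x y : C, linear (@fmap x y);
  fmap1 : forall x : C, fmap (idm x) = idm (fob x);
  fmapM : forall (x y z : C) (g : hom y z) (f : hom x y),
    fmap (g ∘ f) = fmap g ∘ fmap f
}.

Section FmapIso.
Variables (k : fieldType) (C D : linCat k) (F : linFun C D) (x y : C).
Variable u : iso x y.

Fact fmap_iso_homK : fmap F (iso_inv u) ∘ fmap F u = idm (F x).
Proof. by rewrite -fmapM iso_homK fmap1. Qed.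

Fact fmap_iso_invK : fmap F u ∘ fmap F (iso_inv u) = idm (F y).
Proof. by rewrite -fmapM iso_invK fmap1. Qed.

Definition fmap_iso : iso (F x) (F y) := Iso fmap_iso_homK fmap_iso_invK.

End FmapIso.

Section LinFunComp.
Variables (k : fieldType) (C D E : linCat k).

Definition id_fun : linFun C C :=
  @LinFun k C C id (fun x y => id) (fun x y a f g => erefl)
    (fun x => erefl) (fun x y z g f => erefl).

Variables (G : linFun D E) (F : linFun C D).

Fact comp_fun_lin (x y : C) :
  linear ((fun f => fmap G (fmap F f)) : hom x y -> hom (G (F x)) (G (F y))).
Proof. by move=> a f g; rewrite !fmap_lin. Qed.

Fact comp_fun1 (x : C) : fmap G (fmap F (idm x)) = idm (G (F x)).
Proof. by rewrite !fmap1. Qed.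

Fact comp_funM (x y z : C) (g : hom y z) (f : hom x y) :
  fmap G (fmap F (g ∘ f)) = fmap G (fmap F g) ∘ fmap G (fmap F f).
Proof. by rewrite !fmapM. Qed.

Definition comp_fun : linFun C E :=
  @LinFun k C E (fun x => G (F x)) (fun x y f => fmap G (fmap F f))
    comp_fun_lin comp_fun1 comp_funM.

End LinFunComp.
Arguments id_fun {k} C.

Definition naturally_isomorphic (k : fieldType) (C D : linCat k)
    (F G : linFun C D) : Prop :=
  exists u : forall x, iso (F x) (G x),
    forall (x y : C) (f : hom x y), u y ∘ fmap F f = fmap G f ∘ u x.

Definition lin_equivalent (k : fieldType) (C D : linCat k) : Prop :=
  exists (F : linFun C D) (G : linFun D C),
    naturally_isomorphic (comp_fun G F) (id_fun C) /\
    naturally_isomorphic (comp_fun F G) (id_fun D).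

(* [falgType k] is not used here because it excludes the zero algebra, whose
   category of representations is the zero category. *)
Record fdAlg (k : fieldType) := FdAlg {
  alg_vect :> vectType k;
  alg_one : alg_vect;
  alg_mul : alg_vect -> alg_vect -> alg_vect;
  alg_mulA : associative alg_mul;
  alg_mul1l : left_id alg_one alg_mul;
  alg_mul1r : right_id alg_one alg_mul;
  alg_mul_linl : forall b, linear (alg_mul^~ b);
  alg_mul_linr : forall a, linear (alg_mul a)
}.

(* Finite dimensional representations are taken in matrix form: [U a] is the
   matrix of the action of [a] on the column vectors ['cV[k]_(rep_dim U)]. *)
Record rep (k : fieldType) (A : fdAlg k) := Rep {
  rep_dim : nat;
  rep_mx :> A -> 'M[k]_rep_dim;
  rep_lin : linear rep_mx;
  rep1 : rep_mx (alg_one A) = 1%:M;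
  repM : forall a b : A, rep_mx (alg_mul a b) = rep_mx a *m rep_mx b
}.

Section RepCat.
Variables (k : fieldType) (A : fdAlg k).

Definition intertwiner (U V : rep A) : pred 'M[k]_(rep_dim V, rep_dim U) :=
  fun f => `[< forall a : A, f *m U a = V a *m f >].
Arguments intertwiner U V : clear implicits.

Fact intertwiner_submod (U V : rep A) : subsemimod_closed (intertwiner U V).
Proof.
split; first split.
- by apply/asboolP => a; rewrite mul0mx mulmx0.
- move=> f g /asboolP hf /asboolP hg; apply/asboolP => a.
  by rewrite mulmxDl mulmxDr hf hg.
- move=> c f /asboolP hf; apply/asboolP => a.
  by rewrite -scalemxAl -scalemxAr hf.
Qed.

HB.instance Definition _ (U V : rep A) :=
  GRing.isSubmodClosed.Build k _ (intertwiner U V) (intertwiner_submod U V).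

Record rep_hom (U V : rep A) := RepHom {
  rep_hom_mx :> 'M[k]_(rep_dim V, rep_dim U);
  rep_homP : rep_hom_mx \in intertwiner U V
}.

HB.instance Definition _ (U V : rep A) := [isSub for @rep_hom_mx U V].
HB.instance Definition _ (U V : rep A) := [Choice of rep_hom U V by <:].
HB.instance Definition _ (U V : rep A) :=
  [SubChoice_isSubLmodule of rep_hom U V by <:].

Fact rep_id_subproof (U : rep A) : 1%:M \in intertwiner U U.
Proof. by apply/asboolP => a; rewrite mul1mx mulmx1. Qed.

Fact rep_comp_subproof (U V W : rep A) (g : rep_hom V W) (f : rep_hom U V) :
  g *m f \in intertwiner U W.
Proof.
have /asboolP hg := rep_homP g; have /asboolP hf := rep_homP f.
apply/asboolP => a.
by rewrite -mulmxA hf !mulmxA hg.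
Qed.

Definition rep_id (U : rep A) : rep_hom U U := RepHom (rep_id_subproof U).
Definition rep_comp (U V W : rep A) (g : rep_hom V W) (f : rep_hom U V) :
  rep_hom U W := RepHom (rep_comp_subproof g f).

Fact rep_comp1m (U V : rep A) (f : rep_hom U V) : rep_comp (rep_id V) f = f.
Proof. by apply/val_inj; rewrite /= mul1mx. Qed.

Fact rep_compm1 (U V : rep A) (f : rep_hom U V) : rep_comp f (rep_id U) = f.
Proof. by apply/val_inj; rewrite /= mulmx1. Qed.

Fact rep_compA (U V W X : rep A) (h : rep_hom W X) (g : rep_hom V W)
  (f : rep_hom U V) : rep_comp h (rep_comp g f) = rep_comp (rep_comp h g) f.
Proof. by apply/val_inj; rewrite /= mulmxA. Qed.

Fact rep_compDl (U V W : rep A) (f : rep_hom U V) (g g' : rep_hom V W) :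
  rep_comp (g + g') f = rep_comp g f + rep_comp g' f.
Proof. by apply/val_inj; rewrite /= mulmxDl. Qed.

Fact rep_compDr (U V W : rep A) (g : rep_hom V W) (f f' : rep_hom U V) :
  rep_comp g (f + f') = rep_comp g f + rep_comp g f'.
Proof. by apply/val_inj; rewrite /= mulmxDr. Qed.

Definition rep_preadd : preaddCat :=
  @PreaddCat (rep A) rep_hom (fun U V => GRing.Zmodule.class (rep_hom U V))
    rep_id rep_comp rep_comp1m rep_compm1 rep_compA rep_compDl rep_compDr.

Fact rep_compZl (U V W : rep A) (a : k) (g : rep_hom V W) (f : rep_hom U V) :
  rep_comp (a *: g) f = a *: rep_comp g f.
Proof. by apply/val_inj; rewrite /= scalemxAl. Qed.

Fact rep_compZr (U V W : rep A) (a : k) (g : rep_hom V W) (f : rep_hom U V) :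
  rep_comp g (a *: f) = a *: rep_comp g f.
Proof. by apply/val_inj; rewrite /= scalemxAr. Qed.

Definition rep_cat : linCat k :=
  @LinCat k rep_preadd
    (fun U V => GRing.Lmodule.GRing_Nmodule_isLSemiModule_mixin
                  (GRing.Lmodule.class (rep_hom U V)))
    rep_compZl rep_compZr.

End RepCat.

Definition finite_cat (k : fieldType) (C : linCat k) : Prop :=
  exists A : fdAlg k, lin_equivalent C (rep_cat A).

Record monCat (k : fieldType) := MonCat {
  mon_cat :> linCat k;
  tens : mon_cat -> mon_cat -> mon_cat
    where "X ⊗ Y" := (tens X Y);
  tensm : forall X X' Y Y' : mon_cat,
    hom X X' -> hom Y Y' -> hom (X ⊗ Y) (X' ⊗ Y')
    where "f ⊗₁ g" := (tensm f g);
  tens_linl : forall (X X' Y Y' : mon_cat) (g : hom Y Y'),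
    linear ((fun f => f ⊗₁ g) : hom X X' -> hom (X ⊗ Y) (X' ⊗ Y'));
  tens_linr : forall (X X' Y Y' : mon_cat) (f : hom X X'),
    linear ((fun g => f ⊗₁ g) : hom Y Y' -> hom (X ⊗ Y) (X' ⊗ Y'));
  tens1 : forall X Y : mon_cat, idm X ⊗₁ idm Y = idm (X ⊗ Y);
  tensM : forall (X X' X'' Y Y' Y'' : mon_cat)
      (f' : hom X' X'') (f : hom X X') (g' : hom Y' Y'') (g : hom Y Y'),
    (f' ∘ f) ⊗₁ (g' ∘ g) = (f' ⊗₁ g') ∘ (f ⊗₁ g);
  tunit : mon_cat;
  tassoc : forall X Y Z : mon_cat, iso ((X ⊗ Y) ⊗ Z) (X ⊗ (Y ⊗ Z));
  tassoc_nat : forall (X X' Y Y' Z Z' : mon_cat)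
      (f : hom X X') (g : hom Y Y') (h : hom Z Z'),
    tassoc X' Y' Z' ∘ ((f ⊗₁ g) ⊗₁ h) = (f ⊗₁ (g ⊗₁ h)) ∘ tassoc X Y Z;
  tunitl : forall X : mon_cat, iso (tunit ⊗ X) X;
  tunitl_nat : forall (X X' : mon_cat) (f : hom X X'),
    tunitl X' ∘ (idm tunit ⊗₁ f) = f ∘ tunitl X;
  tunitr : forall X : mon_cat, iso (X ⊗ tunit) X;
  tunitr_nat : forall (X X' : mon_cat) (f : hom X X'),
    tunitr X' ∘ (f ⊗₁ idm tunit) = f ∘ tunitr X;
  tens_pentagon : forall W X Y Z : mon_cat,
    tassoc W X (Y ⊗ Z) ∘ tassoc (W ⊗ X) Y Z
    = (idm W ⊗₁ tassoc X Y Z) ∘ tassoc W (X ⊗ Y) Z ∘ (tassoc W X Y ⊗₁ idm Z);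
  tens_triangle : forall X Y : mon_cat,
    (idm X ⊗₁ tunitl Y) ∘ tassoc X tunit Y = tunitr X ⊗₁ idm Y
}.
Arguments tunit {k m}.
Notation "X ⊗ Y" := (tens X Y) : cat_scope.
Notation "f ⊗₁ g" := (tensm f g) : cat_scope.

(* [Y] is a left dual of [X] (equivalently, [X] is a right dual of [Y]). *)
Definition is_left_dual (k : fieldType) (A : monCat k) (X Y : A) : Prop :=
  exists (ev : hom (Y ⊗ X) tunit) (coev : hom tunit (X ⊗ Y)),
    tunitr X ∘ (idm X ⊗₁ ev) ∘ tassoc X Y X ∘ (coev ⊗₁ idm X)
      ∘ iso_inv (tunitl X) = idm X /\
    tunitl Y ∘ (ev ⊗₁ idm Y) ∘ iso_inv (tassoc Y X Y) ∘ (idm Y ⊗₁ coev)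
      ∘ iso_inv (tunitr Y) = idm Y.

Definition rigid (k : fieldType) (A : monCat k) : Prop :=
  forall X : A, (exists Y, is_left_dual X Y) /\ (exists Y, is_left_dual Y X).

Definition finite_multitensor (k : fieldType) (A : monCat k) : Prop :=
  finite_cat A /\ rigid A.

Record modCat (k : fieldType) (A : monCat k) := ModCat {
  mod_cat :> linCat k;
  act : A -> mod_cat -> mod_cat
    where "X ⊙ M" := (act X M);
  actm : forall (X X' : A) (M M' : mod_cat),
    hom X X' -> hom M M' -> hom (X ⊙ M) (X' ⊙ M')
    where "f ⊙₁ g" := (actm f g);
  act_linl : forall (X X' : A) (M M' : mod_cat) (g : hom M M'),
    linear ((fun f => f ⊙₁ g) : hom X X' -> hom (X ⊙ M) (X' ⊙ M'));
  act_linr : forall (X X' : A) (M M' : mod_cat) (f : hom X X'),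
    linear ((fun g => f ⊙₁ g) : hom M M' -> hom (X ⊙ M) (X' ⊙ M'));
  act1 : forall (X : A) (M : mod_cat), idm X ⊙₁ idm M = idm (X ⊙ M);
  actM : forall (X X' X'' : A) (M M' M'' : mod_cat)
      (f' : hom X' X'') (f : hom X X') (g' : hom M' M'') (g : hom M M'),
    (f' ∘ f) ⊙₁ (g' ∘ g) = (f' ⊙₁ g') ∘ (f ⊙₁ g);
  aassoc : forall (X Y : A) (M : mod_cat), iso ((X ⊗ Y) ⊙ M) (X ⊙ (Y ⊙ M));
  aassoc_nat : forall (X X' Y Y' : A) (M M' : mod_cat)
      (f : hom X X') (g : hom Y Y') (h : hom M M'),
    aassoc X' Y' M' ∘ ((f ⊗₁ g) ⊙₁ h) = (f ⊙₁ (g ⊙₁ h)) ∘ aassoc X Y M;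
  aunit : forall M : mod_cat, iso (tunit ⊙ M) M;
  aunit_nat : forall (M M' : mod_cat) (f : hom M M'),
    aunit M' ∘ (idm tunit ⊙₁ f) = f ∘ aunit M;
  act_pentagon : forall (X Y Z : A) (M : mod_cat),
    aassoc X Y (Z ⊙ M) ∘ aassoc (X ⊗ Y) Z M
    = (idm X ⊙₁ aassoc Y Z M) ∘ aassoc X (Y ⊗ Z) M ∘ (tassoc X Y Z ⊙₁ idm M);
  act_triangle : forall (X : A) (M : mod_cat),
    (idm X ⊙₁ aunit M) ∘ aassoc X tunit M = tunitr X ⊙₁ idm M
}.
Notation "X ⊙ M" := (act X M) : cat_scope.
Notation "f ⊙₁ g" := (actm f g) : cat_scope.

Definition exact_mod (k : fieldType) (A : monCat k) (M : modCat A) : Prop :=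
  forall (P : A) (m : M), projective P -> projective (P ⊙ m).

Record modFun (k : fieldType) (A : monCat k) (M N : modCat A) := ModFun {
  mfun :> linFun M N;
  mstr : forall (X : A) (m : M), iso (mfun (X ⊙ m)) (X ⊙ mfun m);
  mstr_nat : forall (X X' : A) (m m' : M) (f : hom X X') (g : hom m m'),
    mstr X' m' ∘ fmap mfun (f ⊙₁ g) = (f ⊙₁ fmap mfun g) ∘ mstr X m;
  mstr_assoc : forall (X Y : A) (m : M),
    aassoc X Y (mfun m) ∘ mstr (X ⊗ Y) m
    = (idm X ⊙₁ mstr Y m) ∘ mstr X (Y ⊙ m) ∘ fmap mfun (aassoc X Y m);
  mstr_unit : forall m : M,
    aunit (mfun m) ∘ mstr tunit m = fmap mfun (aunit m)
}.

Record modTrans (k : fieldType) (A : monCat k) (M N : modCat A)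
    (F G : modFun M N) := ModTrans {
  mtrans :> forall m : M, hom (F m) (G m);
  mtrans_nat : forall (m m' : M) (f : hom m m'),
    mtrans m' ∘ fmap F f = fmap G f ∘ mtrans m;
  mtrans_mod : forall (X : A) (m : M),
    mstr G X m ∘ mtrans (X ⊙ m) = (idm X ⊙₁ mtrans m) ∘ mstr F X m
}.

Section ZeroOpp.
Variables (C : preaddCat) (x y z : C).

Lemma comp0m (f : hom x y) : (0 : hom y z) ∘ f = 0.
Proof. by apply: (addrI ((0 : hom y z) ∘ f)); rewrite -mcompDl !addr0. Qed.

Lemma compm0 (g : hom y z) : g ∘ (0 : hom x y) = 0.
Proof. by apply: (addrI (g ∘ (0 : hom x y))); rewrite -mcompDr !addr0. Qed.

Lemma compNm (g : hom y z) (f : hom x y) : (- g) ∘ f = - (g ∘ f).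
Proof. by apply: (addrI (g ∘ f)); rewrite -mcompDl !subrr comp0m. Qed.

Lemma compmN (g : hom y z) (f : hom x y) : g ∘ (- f) = - (g ∘ f).
Proof. by apply: (addrI (g ∘ f)); rewrite -mcompDr !subrr compm0. Qed.

End ZeroOpp.

Section ActLin.
Variables (k : fieldType) (A : monCat k) (M : modCat A).
Variables (X Y : A) (m n : M) (f : hom X Y).

Lemma actD (g h : hom m n) : f ⊙₁ (g + h) = f ⊙₁ g + f ⊙₁ h.
Proof. by have := act_linr f 1 g h; rewrite !scale1r. Qed.

Lemma act0 : f ⊙₁ (0 : hom m n) = 0.
Proof. by apply: (addrI (f ⊙₁ (0 : hom m n))); rewrite -actD !addr0. Qed.

Lemma actN (g : hom m n) : f ⊙₁ (- g) = - (f ⊙₁ g).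
Proof. by apply: (addrI (f ⊙₁ g)); rewrite -actD !subrr act0. Qed.

End ActLin.

Section ModTrans.
Variables (k : fieldType) (A : monCat k) (M N : modCat A).
Implicit Types F G H K : modFun M N.

Lemma mtransP F G (a b : modTrans F G) : (forall m, a m = b m) -> a = b.
Proof.
case: a b => [a a1 a2] [b b1 b2] /= eq_ab.
have eab : a = b by apply: functional_extensionality_dep.
by subst b; congr ModTrans; apply: Prop_irrelevance.
Qed.

HB.instance Definition _ F G := gen_eqMixin (modTrans F G).
HB.instance Definition _ F G := gen_choiceMixin (modTrans F G).

Fact mtrans0_nat F G (m m' : M) (f : hom m m') :
  (0 : hom (F m') (G m')) ∘ fmap F f = fmap G f ∘ 0.
Proof. by rewrite comp0m compm0. Qed.

Fact mtrans0_mod F G (X : A) (m : M) :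
  mstr G X m ∘ 0 = (idm X ⊙₁ (0 : hom (F m) (G m))) ∘ mstr F X m.
Proof. by rewrite act0 comp0m compm0. Qed.

Definition mtrans0 F G : modTrans F G :=
  ModTrans (@mtrans0_nat F G) (@mtrans0_mod F G).

Fact mtransN_nat F G (a : modTrans F G) (m m' : M) (f : hom m m') :
  (- a m') ∘ fmap F f = fmap G f ∘ (- a m).
Proof. by rewrite compNm compmN mtrans_nat. Qed.

Fact mtransN_mod F G (a : modTrans F G) (X : A) (m : M) :
  mstr G X m ∘ (- a (X ⊙ m)) = (idm X ⊙₁ (- a m)) ∘ mstr F X m.
Proof. by rewrite actN compNm compmN mtrans_mod. Qed.

Definition mtransN F G (a : modTrans F G) : modTrans F G :=
  ModTrans (mtransN_nat a) (mtransN_mod a).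

Fact mtransD_nat F G (a b : modTrans F G) (m m' : M) (f : hom m m') :
  (a m' + b m') ∘ fmap F f = fmap G f ∘ (a m + b m).
Proof. by rewrite mcompDl mcompDr !mtrans_nat. Qed.

Fact mtransD_mod F G (a b : modTrans F G) (X : A) (m : M) :
  mstr G X m ∘ (a (X ⊙ m) + b (X ⊙ m))
  = (idm X ⊙₁ (a m + b m)) ∘ mstr F X m.
Proof. by rewrite actD mcompDl mcompDr !mtrans_mod. Qed.

Definition mtransD F G (a b : modTrans F G) : modTrans F G :=
  ModTrans (mtransD_nat a b) (mtransD_mod a b).

Fact mtrans_addA F G : associative (@mtransD F G).
Proof. by move=> a b c; apply: mtransP => m /=; rewrite addrA. Qed.

Fact mtrans_addC F G : commutative (@mtransD F G).
Proof. by move=> a b; apply: mtransP => m /=; rewrite addrC. Qed.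

Fact mtrans_add0 F G : left_id (mtrans0 F G) (@mtransD F G).
Proof. by move=> a; apply: mtransP => m /=; rewrite add0r. Qed.

Fact mtrans_addN F G : left_inverse (mtrans0 F G) (@mtransN F G) (@mtransD F G).
Proof. by move=> a; apply: mtransP => m /=; rewrite addNr. Qed.

HB.instance Definition _ F G := GRing.isZmodule.Build (modTrans F G)
  (@mtrans_addA F G) (@mtrans_addC F G) (@mtrans_add0 F G) (@mtrans_addN F G).

Fact mtrans_id_nat F (m m' : M) (f : hom m m') :
  idm (F m') ∘ fmap F f = fmap F f ∘ idm (F m).
Proof. by rewrite mcomp1m mcompm1. Qed.

Fact mtrans_id_mod F (X : A) (m : M) :
  mstr F X m ∘ idm (F (X ⊙ m)) = (idm X ⊙₁ idm (F m)) ∘ mstr F X m.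
Proof. by rewrite act1 mcomp1m mcompm1. Qed.

Definition mtrans_id F : modTrans F F :=
  ModTrans (@mtrans_id_nat F) (@mtrans_id_mod F).

Fact vcomp_nat F G H (b : modTrans G H) (a : modTrans F G) (m m' : M)
  (f : hom m m') : (b m' ∘ a m') ∘ fmap F f = fmap H f ∘ (b m ∘ a m).
Proof. by rewrite -mcompA mtrans_nat !mcompA mtrans_nat. Qed.

Fact vcomp_mod F G H (b : modTrans G H) (a : modTrans F G) (X : A) (m : M) :
  mstr H X m ∘ (b (X ⊙ m) ∘ a (X ⊙ m)) = (idm X ⊙₁ (b m ∘ a m)) ∘ mstr F X m.
Proof.
rewrite mcompA mtrans_mod -mcompA mtrans_mod mcompA.
by rewrite -(mcomp1m (idm X)) actM mcomp1m.
Qed.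

Definition vcomp F G H (b : modTrans G H) (a : modTrans F G) : modTrans F H :=
  ModTrans (vcomp_nat b a) (vcomp_mod b a).

Fact vcomp1m F G (a : modTrans F G) : vcomp (mtrans_id G) a = a.
Proof. by apply: mtransP => m; rewrite /= mcomp1m. Qed.

Fact vcompm1 F G (a : modTrans F G) : vcomp a (mtrans_id F) = a.
Proof. by apply: mtransP => m; rewrite /= mcompm1. Qed.

Fact vcompA F G H K (c : modTrans H K) (b : modTrans G H) (a : modTrans F G) :
  vcomp c (vcomp b a) = vcomp (vcomp c b) a.
Proof. by apply: mtransP => m; rewrite /= mcompA. Qed.

Fact vcompDl F G H (a : modTrans F G) (b b' : modTrans G H) :
  vcomp (b + b') a = vcomp b a + vcomp b' a.
Proof. by apply: mtransP => m; rewrite /= mcompDl. Qed.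

Fact vcompDr F G H (b : modTrans G H) (a a' : modTrans F G) :
  vcomp b (a + a') = vcomp b a + vcomp b a'.
Proof. by apply: mtransP => m; rewrite /= mcompDr. Qed.

Definition modFun_cat : preaddCat :=
  @PreaddCat (modFun M N) (@modTrans k A M N)
    (fun F G => GRing.Zmodule.class (modTrans F G : zmodType))
    mtrans_id vcomp vcomp1m vcompm1 vcompA vcompDl vcompDr.

Definition mtrans_iso F G (a : modTrans F G) (b : modTrans G F)
    (ba : forall m, b m ∘ a m = idm (F m))
    (ab : forall m, a m ∘ b m = idm (G m)) :
    @iso modFun_cat F G :=
  @Iso modFun_cat F G a b (mtransP (a := vcomp b a) (b := mtrans_id F) ba)
    (mtransP (a := vcomp a b) (b := mtrans_id G) ab).

End ModTrans.

Section IdModFun.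
Variables (k : fieldType) (A : monCat k) (M : modCat A).

Fact id_mstr_nat (X X' : A) (m m' : M) (f : hom X X') (g : hom m m') :
  idm (X' ⊙ m') ∘ (f ⊙₁ g) = (f ⊙₁ g) ∘ idm (X ⊙ m).
Proof. by rewrite mcomp1m mcompm1. Qed.

Fact id_mstr_assoc (X Y : A) (m : M) :
  aassoc X Y m ∘ idm ((X ⊗ Y) ⊙ m)
  = (idm X ⊙₁ idm (Y ⊙ m)) ∘ idm (X ⊙ (Y ⊙ m)) ∘ aassoc X Y m.
Proof. by rewrite act1 /= !mcomp1m mcompm1. Qed.

Fact id_mstr_unit (m : M) : aunit m ∘ idm (tunit ⊙ m) = aunit m.
Proof. by rewrite mcompm1. Qed.

Definition id_modFun : modFun M M :=
  @ModFun k A M M (id_fun M) (fun X m => id_iso (X ⊙ m))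
    id_mstr_nat id_mstr_assoc id_mstr_unit.

End IdModFun.
Arguments id_modFun {k A} M.

Section CompModFun.
Variables (k : fieldType) (A : monCat k) (M N P : modCat A).
Variables (G : modFun N P) (F : modFun M N).

Definition comp_mstr (X : A) (m : M) : iso (G (F (X ⊙ m))) (X ⊙ G (F m)) :=
  comp_iso (mstr G X (F m)) (fmap_iso G (mstr F X m)).

Fact comp_mstr_nat (X X' : A) (m m' : M) (f : hom X X') (g : hom m m') :
  comp_mstr X' m' ∘ fmap G (fmap F (f ⊙₁ g))
  = (f ⊙₁ fmap G (fmap F g)) ∘ comp_mstr X m.
Proof.
by rewrite /= -mcompA -fmapM mstr_nat fmapM mcompA mstr_nat mcompA.
Qed.

Fact comp_mstr_assoc (X Y : A) (m : M) :
  aassoc X Y (G (F m)) ∘ comp_mstr (X ⊗ Y) m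
  = (idm X ⊙₁ comp_mstr Y m) ∘ comp_mstr X (Y ⊙ m)
      ∘ fmap G (fmap F (aassoc X Y m)).
Proof.
rewrite /= mcompA mstr_assoc -!mcompA -!fmapM mstr_assoc !fmapM.
rewrite -[in RHS](mcomp1m (idm X)) actM !mcompA; congr (_ ∘ _ ∘ _).
by rewrite -!mcompA mstr_nat.
Qed.

Fact comp_mstr_unit (m : M) :
  aunit (G (F m)) ∘ comp_mstr tunit m = fmap G (fmap F (aunit m)).
Proof. by rewrite /= mcompA mstr_unit -fmapM mstr_unit. Qed.

Definition comp_modFun : modFun M P :=
  @ModFun k A M P (comp_fun G F) comp_mstr
    comp_mstr_nat comp_mstr_assoc comp_mstr_unit.

End CompModFun.

Section HComp.
Variables (k : fieldType) (A : monCat k) (M N P : modCat A).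
Variables (G G' : modFun N P) (F F' : modFun M N).
Variables (b : modTrans G G') (a : modTrans F F').

Let hcomp_fun (m : M) : hom (G (F m)) (G' (F' m)) := b (F' m) ∘ fmap G (a m).

Fact hcomp_nat (m m' : M) (f : hom m m') :
  hcomp_fun m' ∘ fmap (comp_modFun G F) f
  = fmap (comp_modFun G' F') f ∘ hcomp_fun m.
Proof.
rewrite /hcomp_fun /= -mcompA -fmapM (mtrans_nat a) fmapM mcompA.
by rewrite (mtrans_nat b) mcompA.
Qed.

Fact hcomp_mod (X : A) (m : M) :
  mstr (comp_modFun G' F') X m ∘ hcomp_fun (X ⊙ m)
  = (idm X ⊙₁ hcomp_fun m) ∘ mstr (comp_modFun G F) X m.
Proof.
rewrite /hcomp_fun /= -mcompA [fmap G' _ ∘ _]mcompA -(mtrans_nat b).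
rewrite -!mcompA -fmapM (mtrans_mod a) fmapM !mcompA (mtrans_mod b).
rewrite -[idm X in RHS](mcomp1m (idm X)) actM -!mcompA; congr (_ ∘ _).
by rewrite !mcompA mstr_nat.
Qed.

Definition hcomp : modTrans (comp_modFun G F) (comp_modFun G' F') :=
  @ModTrans k A M P (comp_modFun G F) (comp_modFun G' F') hcomp_fun
    hcomp_nat hcomp_mod.

End HComp.

(* The Hom categories carry the addition of 2-cells as part of the data; that
   they are additive, and that composition respects addition, is imposed
   separately below. [b ⊚₂ a] is horizontal composition and [b ∘ a], in a Hom
   category, is vertical composition. *)
Record bicategory := Bicategory {
  bob :> Type;
  bhom : bob -> bob -> preaddCat;
  bid : forall X, bhom X X;
  bcomp : forall X Y Z, bhom Y Z -> bhom X Y -> bhom X Z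
    where "g ⊚ f" := (bcomp g f);
  bcomp2 : forall X Y Z (g g' : bhom Y Z) (f f' : bhom X Y),
    hom g g' -> hom f f' -> hom (g ⊚ f) (g' ⊚ f')
    where "b ⊚₂ a" := (bcomp2 b a);
  bcomp2_id : forall X Y Z (g : bhom Y Z) (f : bhom X Y),
    idm g ⊚₂ idm f = idm (g ⊚ f);
  bcomp2_comp : forall X Y Z (g g' g'' : bhom Y Z) (f f' f'' : bhom X Y)
      (b' : hom g' g'') (b : hom g g') (a' : hom f' f'') (a : hom f f'),
    (b' ∘ b) ⊚₂ (a' ∘ a) = (b' ⊚₂ a') ∘ (b ⊚₂ a);
  bassoc : forall W X Y Z (h : bhom Y Z) (g : bhom X Y) (f : bhom W X),
    iso ((h ⊚ g) ⊚ f) (h ⊚ (g ⊚ f));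
  bassoc_nat : forall W X Y Z (h h' : bhom Y Z) (g g' : bhom X Y)
      (f f' : bhom W X) (c : hom h h') (b : hom g g') (a : hom f f'),
    bassoc h' g' f' ∘ ((c ⊚₂ b) ⊚₂ a) = (c ⊚₂ (b ⊚₂ a)) ∘ bassoc h g f;
  bunitl : forall X Y (f : bhom X Y), iso (bid Y ⊚ f) f;
  bunitl_nat : forall X Y (f f' : bhom X Y) (a : hom f f'),
    bunitl f' ∘ (idm (bid Y) ⊚₂ a) = a ∘ bunitl f;
  bunitr : forall X Y (f : bhom X Y), iso (f ⊚ bid X) f;
  bunitr_nat : forall X Y (f f' : bhom X Y) (a : hom f f'),
    bunitr f' ∘ (a ⊚₂ idm (bid X)) = a ∘ bunitr f;
  bpentagon : forall V W X Y Z
      (i : bhom Y Z) (h : bhom X Y) (g : bhom W X) (f : bhom V W),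
    bassoc i h (g ⊚ f) ∘ bassoc (i ⊚ h) g f
    = (idm i ⊚₂ bassoc h g f) ∘ bassoc i (h ⊚ g) f ∘ (bassoc i h g ⊚₂ idm f);
  btriangle : forall X Y Z (g : bhom Y Z) (f : bhom X Y),
    (idm g ⊚₂ bunitl f) ∘ bassoc g (bid Y) f = bunitr g ⊚₂ idm f
}.
Arguments bhom {b} X Y : rename.
Arguments bid {b} X : rename.
Notation "g ⊚ f" := (bcomp g f) : cat_scope.
Notation "b ⊚₂ a" := (bcomp2 b a) : cat_scope.

Definition locally_additive (B : bicategory) : Prop :=
  [/\ forall X Y : B, additive_cat (bhom X Y),
      forall (X Y Z : B) (g g' : bhom Y Z) (f : bhom X Y) (b b' : hom g g'),
        (b + b') ⊚₂ idm f = b ⊚₂ idm f + b' ⊚₂ idm f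
    & forall (X Y Z : B) (g : bhom Y Z) (f f' : bhom X Y) (a a' : hom f f'),
        idm g ⊚₂ (a + a') = idm g ⊚₂ a + idm g ⊚₂ a'].

Definition is_direct_sum (B : bicategory) (n : nat) (F : 'I_n -> B) (X : B) :
    Prop :=
  exists (i : forall j, bhom (F j) X) (p : forall j, bhom X (F j)),
    [/\ forall j, isomorphic (p j ⊚ i j) (bid (F j)),
        forall j l, j != l -> is_zero (p j ⊚ i l)
      & exists2 s, is_biproduct (fun j => i j ⊚ p j) s & isomorphic s (bid X)].

Definition additive_bicat (B : bicategory) : Prop :=
  locally_additive B /\
  forall (n : nat) (F : 'I_n -> B), exists X, is_direct_sum F X.

Definition zero_object (B : bicategory) (X : B) : Prop :=
  exists F : 'I_0 -> B, is_direct_sum F X.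

Definition equivalent (B : bicategory) (X Y : B) : Prop :=
  exists (f : bhom X Y) (g : bhom Y X),
    isomorphic (g ⊚ f) (bid X) /\ isomorphic (f ⊚ g) (bid Y).

Definition strongly_indecomposable (B : bicategory) (X : B) : Prop :=
  [/\ ~ zero_object X,
      idm (bid X) <> 0
    & forall e : hom (bid X) (bid X), e ∘ e = e -> e = 0 \/ e = idm (bid X)].

Definition krull_schmidt (B : bicategory) : Prop :=
  additive_bicat B /\
  forall X : B, ~ zero_object X ->
    exists (n : nat) (F : 'I_n -> B) (Y : B),
      [/\ forall j, strongly_indecomposable (F j),
          is_direct_sum F Y
        & equivalent X Y].

Definition full_subbicat (B : bicategory) (Q : B -> Prop) : bicategory :=
  @Bicategory {X : B | Q X} (fun X Y => bhom (sval X) (sval Y))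
    (fun X => bid (sval X))
    (fun X Y Z g f => g ⊚ f)
    (fun X Y Z g g' f f' b a => b ⊚₂ a)
    (fun X Y Z => @bcomp2_id B _ _ _)
    (fun X Y Z => @bcomp2_comp B _ _ _)
    (fun W X Y Z => @bassoc B _ _ _ _)
    (fun W X Y Z => @bassoc_nat B _ _ _ _)
    (fun X Y => @bunitl B _ _)
    (fun X Y => @bunitl_nat B _ _)
    (fun X Y => @bunitr B _ _)
    (fun X Y => @bunitr_nat B _ _)
    (fun V W X Y Z => @bpentagon B _ _ _ _ _)
    (fun X Y Z => @btriangle B _ _ _).

Section ModBicat.
Variables (k : fieldType) (A : monCat k).
Implicit Types M N P Q R : modCat A.

Fact hcomp_id M N P (G : modFun N P) (F : modFun M N) :
  hcomp (mtrans_id G) (mtrans_id F) = mtrans_id (comp_modFun G F).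
Proof. by apply: mtransP => m; rewrite /= fmap1 mcomp1m. Qed.

Fact hcomp_comp M N P (G G' G'' : modFun N P) (F F' F'' : modFun M N)
    (b' : modTrans G' G'') (b : modTrans G G')
    (a' : modTrans F' F'') (a : modTrans F F') :
  hcomp (vcomp b' b) (vcomp a' a) = vcomp (hcomp b' a') (hcomp b a).
Proof.
apply: mtransP => m /=; rewrite fmapM -!mcompA; congr (_ ∘ _).
by rewrite !mcompA mtrans_nat.
Qed.

(* Composition of module functors is strictly associative and unital on
   underlying functors, so the constraints have identity components. *)
Section Constraints.
Variables (M N P Q : modCat A).
Variables (H : modFun P Q) (G : modFun N P) (F : modFun M N).

Fact assoc_mod (X : A) (m : M) :
  mstr (comp_modFun H (comp_modFun G F)) X m ∘ idm (H (G (F (X ⊙ m))))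
  = (idm X ⊙₁ idm (H (G (F m)))) ∘ mstr (comp_modFun (comp_modFun H G) F) X m.
Proof. by rewrite act1 mcomp1m mcompm1 /= fmapM mcompA. Qed.

Fact assoc_inv_mod (X : A) (m : M) :
  mstr (comp_modFun (comp_modFun H G) F) X m ∘ idm (H (G (F (X ⊙ m))))
  = (idm X ⊙₁ idm (H (G (F m)))) ∘ mstr (comp_modFun H (comp_modFun G F)) X m.
Proof. by rewrite act1 mcomp1m mcompm1 /= fmapM mcompA. Qed.

Fact unitl_mod (X : A) (m : M) :
  mstr F X m ∘ idm (F (X ⊙ m))
  = (idm X ⊙₁ idm (F m)) ∘ mstr (comp_modFun (id_modFun N) F) X m.
Proof. by rewrite act1 /= !mcomp1m mcompm1. Qed.

Fact unitl_inv_mod (X : A) (m : M) :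
  mstr (comp_modFun (id_modFun N) F) X m ∘ idm (F (X ⊙ m))
  = (idm X ⊙₁ idm (F m)) ∘ mstr F X m.
Proof. by rewrite act1 /= !mcomp1m mcompm1. Qed.

Fact unitr_mod (X : A) (m : M) :
  mstr F X m ∘ idm (F (X ⊙ m))
  = (idm X ⊙₁ idm (F m)) ∘ mstr (comp_modFun F (id_modFun M)) X m.
Proof. by rewrite act1 !mcomp1m mcompm1 /= fmap1 mcompm1. Qed.

Fact unitr_inv_mod (X : A) (m : M) :
  mstr (comp_modFun F (id_modFun M)) X m ∘ idm (F (X ⊙ m))
  = (idm X ⊙₁ idm (F m)) ∘ mstr F X m.
Proof. by rewrite act1 !mcomp1m mcompm1 /= fmap1 mcompm1. Qed.

Definition mod_assoc :
    @iso (modFun_cat M Q) (comp_modFun (comp_modFun H G) F)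
                          (comp_modFun H (comp_modFun G F)) :=
  mtrans_iso
    (a := @ModTrans k A M Q (comp_modFun (comp_modFun H G) F)
            (comp_modFun H (comp_modFun G F)) (fun m => idm (H (G (F m))))
            (mtrans_id_nat (comp_modFun H (comp_modFun G F))) assoc_mod)
    (b := @ModTrans k A M Q (comp_modFun H (comp_modFun G F))
            (comp_modFun (comp_modFun H G) F) (fun m => idm (H (G (F m))))
            (mtrans_id_nat (comp_modFun H (comp_modFun G F))) assoc_inv_mod)
    (fun m => mcomp1m _) (fun m => mcomp1m _).

Definition mod_unitl : @iso (modFun_cat M N) (comp_modFun (id_modFun N) F) F :=
  mtrans_iso
    (a := @ModTrans k A M N (comp_modFun (id_modFun N) F) F
            (fun m => idm (F m)) (mtrans_id_nat F) unitl_mod)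
    (b := @ModTrans k A M N F (comp_modFun (id_modFun N) F)
            (fun m => idm (F m)) (mtrans_id_nat F) unitl_inv_mod)
    (fun m => mcomp1m _) (fun m => mcomp1m _).

Definition mod_unitr : @iso (modFun_cat M N) (comp_modFun F (id_modFun M)) F :=
  mtrans_iso
    (a := @ModTrans k A M N (comp_modFun F (id_modFun M)) F
            (fun m => idm (F m)) (mtrans_id_nat F) unitr_mod)
    (b := @ModTrans k A M N F (comp_modFun F (id_modFun M))
            (fun m => idm (F m)) (mtrans_id_nat F) unitr_inv_mod)
    (fun m => mcomp1m _) (fun m => mcomp1m _).

End Constraints.

Fact mod_assoc_nat M N P Q (H H' : modFun P Q) (G G' : modFun N P)
    (F F' : modFun M N) (c : modTrans H H') (b : modTrans G G')
    (a : modTrans F F') :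
  vcomp (iso_hom (mod_assoc H' G' F')) (hcomp (hcomp c b) a)
  = vcomp (hcomp c (hcomp b a)) (iso_hom (mod_assoc H G F)).
Proof.
by apply: mtransP => m; rewrite /= mcomp1m mcompm1 fmapM mcompA.
Qed.

Fact mod_unitl_nat M N (F F' : modFun M N) (a : modTrans F F') :
  vcomp (iso_hom (mod_unitl F')) (hcomp (mtrans_id (id_modFun N)) a)
  = vcomp a (iso_hom (mod_unitl F)).
Proof. by apply: mtransP => m; rewrite /= !mcomp1m mcompm1. Qed.

Fact mod_unitr_nat M N (F F' : modFun M N) (a : modTrans F F') :
  vcomp (iso_hom (mod_unitr F')) (hcomp a (mtrans_id (id_modFun M)))
  = vcomp a (iso_hom (mod_unitr F)).
Proof. by apply: mtransP => m; rewrite /= mcomp1m fmap1. Qed.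

Fact mod_pentagon M N P Q R (K : modFun Q R) (H : modFun P Q)
    (G : modFun N P) (F : modFun M N) :
  vcomp (iso_hom (mod_assoc K H (comp_modFun G F)))
        (iso_hom (mod_assoc (comp_modFun K H) G F))
  = vcomp (vcomp (hcomp (mtrans_id K) (iso_hom (mod_assoc H G F)))
                 (iso_hom (mod_assoc K (comp_modFun H G) F)))
          (hcomp (iso_hom (mod_assoc K H G)) (mtrans_id F)).
Proof. by apply: mtransP => m; rewrite /= !fmap1 !mcomp1m. Qed.

Fact mod_triangle M N P (G : modFun N P) (F : modFun M N) :
  vcomp (hcomp (mtrans_id G) (iso_hom (mod_unitl F)))
        (iso_hom (mod_assoc G (id_modFun N) F))
  = hcomp (iso_hom (mod_unitr G)) (mtrans_id F).
Proof. by apply: mtransP => m; rewrite /= !mcompm1 mcomp1m. Qed.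

Definition modBicat : bicategory :=
  @Bicategory (modCat A) (@modFun_cat k A) id_modFun (@comp_modFun k A)
    (@hcomp k A) hcomp_id hcomp_comp mod_assoc mod_assoc_nat
    mod_unitl mod_unitl_nat mod_unitr mod_unitr_nat mod_pentagon mod_triangle.

Definition finModBicat : bicategory :=
  full_subbicat (B := modBicat) (fun M : modCat A => finite_cat M).

Definition exactModBicat : bicategory :=
  full_subbicat (B := finModBicat)
    (fun M : {M : modCat A | finite_cat M} => exact_mod (sval M)).

End ModBicat.

(* Main.v *)
From HB Require Import structures.
From mathcomp Require Import all_boot all_order all_algebra.
From mathcomp Require Import boolp.
Require Import Defs.

(** Everything rests on the ring [End(id_M)] of module endomorphisms of the
    identity functor of a finite module category [M]. If [M] is, as a linear
    category, [Rep R] for a finite dimensional algebra [R], then a natural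
    endomorphism of the identity is multiplication by a central element of [R]
    (natural_endo_scalar). Orthogonal nonzero idempotents of [End(id_M)] thus
    give linearly independent elements of [R], and their number is bounded
    (orthogonal_natural_bound). A complete orthogonal family of idempotents of
    maximal size then consists of primitive ones (primitive_decomposition).

    An idempotent [e] of [End(id_M)] cuts out the full subcategory [M_e] of the
    objects on which [e] is the identity. It is stable under the action because
    [e] is a module transformation, and it is finite, being equivalent to
    [Rep (zR)] where [z] is the central idempotent given by [e] (block_finite).
    Idempotents split in [M], so [m |-> im (e m)] is a module functor onto [M_e],
    and a complete orthogonal family exhibits [M] as the direct sum of the
    [M_(e j)] (blocks_direct_sum). As [End(id_(M_e))] is the corner
    [e End(id_M) e], it is connected when [e] is primitive
    (blockMod_strongly_indecomposable).

    Additivity: direct sums of module functors are formed objectwise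
    (modFun_additive), and the direct sum of finitely many module categories is
    their product (prodMod_direct_sum), which is finite because the product of
    the categories [Rep (R j)] is the category of representations of the product
    algebra (prod_finite).

    Exactness is inherited by products and by the [M_e]: an epimorphism of a
    product is an epimorphism in each coordinate, and an epimorphism of [M_e] is
    one of [M], so that projectivity of [P ⊙ m] follows from that of its
    coordinates, respectively from that in [M] (prodMod_exact, blockMod_exact).
    Hence the same argument covers exact module categories
    (krull_schmidt_along). *)

Set Implicit Arguments.
Unset Strict Implicit.
Unset Printing Implicit Defensive.

Import GRing.Theory VectorInternalTheory.
Local Open Scope ring_scope.
Local Open Scope cat_scope.

(** * Biproducts *)

Section Sums.
Variables (C : preaddCat) (x y z : C) (I : finType).

Lemma mcomp_suml (f : hom x y) (g : I -> hom y z) :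
  (\sum_j g j) ∘ f = \sum_j (g j ∘ f).
Proof.
apply: (big_morph (fun h : hom y z => h ∘ f)) => [g1 g2|].
  exact: mcompDl.
exact: comp0m.
Qed.

Lemma mcomp_sumr (g : hom y z) (f : I -> hom x y) :
  g ∘ (\sum_j f j) = \sum_j (g ∘ f j).
Proof.
apply: (big_morph (fun h : hom x y => g ∘ h)) => [f1 f2|].
  exact: mcompDr.
exact: compm0.
Qed.

End Sums.

Record biprod (C : preaddCat) (n : nat) (F : 'I_n -> C) := Biprod {
  bp_ob :> C;
  bp_in : forall j, hom (F j) bp_ob;
  bp_pr : forall j, hom bp_ob (F j);
  bp_prin : forall j, bp_pr j ∘ bp_in j = idm (F j);
  bp_prin0 : forall j l, j != l -> bp_pr j ∘ bp_in l = 0;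
  bp_sum : \sum_j (bp_in j ∘ bp_pr j) = idm bp_ob
}.

Section Biprod.
Variables (C : preaddCat) (n : nat) (F : 'I_n -> C).

Lemma biprodP (s : C) : is_biproduct F s <-> exists B : biprod F, bp_ob B = s.
Proof.
split=> [[i [p [pi pi0 ip]]] | [B <-]].
  by exists (Biprod pi pi0 ip).
exists (bp_in B), (bp_pr B); split.
- exact: bp_prin.
- exact: bp_prin0.
- exact: bp_sum.
Qed.

Lemma choose_biprod : additive_cat C -> biprod F.
Proof.
move=> addC; have [s /biprodP hs] := cid (addC n F).
by have [B _] := cid hs.
Qed.

Variable B : biprod F.

Definition copair (z : C) (g : forall j, hom (F j) z) : hom B z :=
  \sum_j (g j ∘ bp_pr B j).

Lemma copair_in (z : C) (g : forall j, hom (F j) z) (j : 'I_n) :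
  copair g ∘ bp_in B j = g j.
Proof.
rewrite /copair mcomp_suml (bigD1 j) //= -mcompA bp_prin mcompm1.
rewrite big1 ?addr0 // => l lj.
by rewrite -mcompA bp_prin0 // compm0.
Qed.

Lemma biprod_ext (z : C) (f g : hom B z) :
  (forall j, f ∘ bp_in B j = g ∘ bp_in B j) -> f = g.
Proof.
move=> fg; rewrite -[f]mcompm1 -[g]mcompm1 -bp_sum !mcomp_sumr.
by apply: eq_bigr => j _; rewrite !mcompA fg.
Qed.

Lemma biprod_iso (G : 'I_n -> C) (u : forall j, iso (G j) (F j)) :
  is_biproduct G B.
Proof.
exists (fun j => bp_in B j ∘ u j), (fun j => iso_inv (u j) ∘ bp_pr B j).
split=> [j | j l jl |].
- by rewrite -mcompA [bp_pr B j ∘ _]mcompA bp_prin mcomp1m iso_homK.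
- by rewrite -mcompA [bp_pr B j ∘ _]mcompA bp_prin0 // comp0m compm0.
- rewrite -bp_sum; apply: eq_bigr => j _.
  by rewrite -mcompA [u j ∘ _]mcompA iso_invK mcomp1m.
Qed.

End Biprod.

Lemma biprod_unique (C : preaddCat) (n : nat) (F : 'I_n -> C)
  (B B' : biprod F) : isomorphic B B'.
Proof.
split; apply: (@Iso _ _ _ (copair B (bp_in B')) (copair B' (bp_in B)));
  by apply: biprod_ext => j; rewrite -mcompA !copair_in mcomp1m.
Qed.

Lemma is_zeroP (C : preaddCat) (z : C) : idm z = 0 -> is_zero z.
Proof.
move=> z0 x; split=> f; first by rewrite -[f]mcomp1m z0 comp0m.
by rewrite -[f]mcompm1 z0 compm0.
Qed.

Lemma biprod0_idm (C : preaddCat) (F : 'I_0 -> C) (s : C) :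
  is_biproduct F s -> idm s = 0.
Proof. by case=> i [p [_ _ <-]]; rewrite big_ord0. Qed.

Lemma iso_idm0 (C : preaddCat) (x y : C) : iso x y -> idm x = 0 -> idm y = 0.
Proof. by move=> u x0; rewrite -(iso_invK u) -[iso_hom u]mcompm1 x0 !compm0 comp0m. Qed.

(** * Splitting idempotents *)

Record splitting (C : preaddCat) (x : C) (e : hom x x) := Splitting {
  sp_ob :> C;
  sp_in : hom sp_ob x;
  sp_pr : hom x sp_ob;
  sp_prin : sp_pr ∘ sp_in = idm sp_ob;
  sp_inpr : sp_in ∘ sp_pr = e
}.

Definition idempotents_split (C : preaddCat) : Prop :=
  forall (x : C) (e : hom x x), e ∘ e = e -> inhabited (splitting e).

Section SplittingLemmas.
Variables (C : preaddCat) (x : C) (e : hom x x) (S : splitting e).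

Lemma sp_pr_idem : sp_pr S ∘ e = sp_pr S.
Proof.
transitivity (sp_pr S ∘ (sp_in S ∘ sp_pr S)); first by rewrite sp_inpr.
by rewrite mcompA sp_prin mcomp1m.
Qed.

Lemma sp_idem_in : e ∘ sp_in S = sp_in S.
Proof.
transitivity (sp_in S ∘ sp_pr S ∘ sp_in S); first by rewrite sp_inpr.
by rewrite -mcompA sp_prin mcompm1.
Qed.

End SplittingLemmas.

(** Orthogonality passes from the idempotents to their splittings because
    [p_j i_l = p_j e_j e_l i_l]. *)
Lemma splitting_biprod (C : preaddCat) (n : nat) (x : C) (e : 'I_n -> hom x x)
    (S : forall j, splitting (e j)) :
  (forall j l, j != l -> e j ∘ e l = 0) -> \sum_j e j = idm x ->
  is_biproduct (fun j => S j) x.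
Proof.
move=> e0 e1; exists (fun j => sp_in (S j)), (fun j => sp_pr (S j)).
split=> [j | j l jl |]; first exact: sp_prin.
  rewrite -sp_pr_idem -[sp_in (S l)]sp_idem_in.
  by rewrite mcompA -[_ ∘ e j ∘ e l]mcompA e0 // compm0 comp0m.
by rewrite -e1; apply: eq_bigr => j _; rewrite sp_inpr.
Qed.

(** * Linear functors and equivalences *)

Section FunctorLin.
Variables (k : fieldType) (C D : linCat k) (F : linFun C D) (x y : C).

Lemma fmapD (f g : hom x y) : fmap F (f + g) = fmap F f + fmap F g.
Proof. by have := fmap_lin F 1 f g; rewrite !scale1r. Qed.

Lemma fmap0 : fmap F (0 : hom x y) = 0.
Proof. by apply: (addrI (fmap F (0 : hom x y))); rewrite -fmapD !addr0. Qed.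

Lemma fmap_sum (I : finType) (f : I -> hom x y) :
  fmap F (\sum_j f j) = \sum_j fmap F (f j).
Proof.
apply: (big_morph (fun h : hom x y => fmap F h)) => [g h|].
  exact: fmapD.
exact: fmap0.
Qed.

End FunctorLin.

Lemma compDZl (k : fieldType) (C : linCat k) (x y z : C) a (g g' : hom y z)
  (f : hom x y) : (a *: g + g') ∘ f = a *: (g ∘ f) + g' ∘ f.
Proof. by rewrite mcompDl; congr (_ + _); exact: mcompZl. Qed.

Lemma compDZr (k : fieldType) (C : linCat k) (x y z : C) a (g : hom y z)
  (f f' : hom x y) : g ∘ (a *: f + f') = a *: (g ∘ f) + g ∘ f'.
Proof. by rewrite mcompDr; congr (_ + _); exact: mcompZr. Qed.

Definition fully_faithful (k : fieldType) (C D : linCat k) (F : linFun C D) :=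
  forall x y : C, injective (@fmap k C D F x y) /\
    forall h : hom (F x) (F y), exists f, fmap F f = h.

Definition weak_equiv (k : fieldType) (C D : linCat k) (F : linFun C D) :=
  fully_faithful F /\ forall d, exists x, isomorphic (F x) d.

Section FullyFaithful.
Variables (k : fieldType) (C D : linCat k) (F : linFun C D).
Hypothesis ffF : fully_faithful F.

Lemma fmap_inj (x y : C) : injective (@fmap k C D F x y).
Proof. by have [] := ffF x y. Qed.

Definition fpreim (x y : C) (h : hom (F x) (F y)) : hom x y :=
  sval (cid ((ffF x y).2 h)).

Lemma fmap_fpreim (x y : C) (h : hom (F x) (F y)) : fmap F (fpreim h) = h.
Proof. by rewrite /fpreim; case: cid. Qed.

End FullyFaithful.

Section WeakEquiv.
Variables (k : fieldType) (C D : linCat k).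

Lemma lin_equivalent_weak : lin_equivalent C D -> exists F : linFun C D, weak_equiv F.
Proof.
case=> F [G [[u un] [v vn]]]; exists F.
have injF x y : injective (@fmap k C D F x y).
  move=> f g fg; have := un _ _ f; rewrite /= fg => h.
  have := un _ _ g; rewrite /= h => {}h.
  by rewrite -[f]mcompm1 -[g]mcompm1 -(iso_invK (u x)) !mcompA h.
have injG x y : injective (@fmap k D C G x y).
  move=> f g fg; have := vn _ _ f; rewrite /= fg => h.
  have := vn _ _ g; rewrite /= h => {}h.
  by rewrite -[f]mcompm1 -[g]mcompm1 -(iso_invK (v x)) !mcompA h.
split; last by move=> d; exists (G d); split; exact: v.
move=> x y; split=> [|h]; first exact: injF.
exists (u y ∘ fmap G h ∘ iso_inv (u x)); apply: injG.
have := un _ _ (u y ∘ fmap G h ∘ iso_inv (u x)); rewrite /=.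
rewrite -!mcompA iso_homK mcompm1.
move/(congr1 (fun t => iso_inv (u y) ∘ t)).
by rewrite !mcompA iso_homK !mcomp1m.
Qed.

Section Inverse.
Variable F : linFun C D.
Hypothesis weF : weak_equiv F.
Let ffF : fully_faithful F. Proof. by case: weF. Qed.

Let ws_ex (d : D) : {x : C & iso (F x) d}.
Proof. by have [x hx] := cid (weF.2 d); exists x; apply: inhabited_witness hx. Qed.

Let ws (d : D) : C := projT1 (ws_ex d).
Let wi (d : D) : iso (F (ws d)) d := projT2 (ws_ex d).
Let wmap (d d' : D) (h : hom d d') : hom (ws d) (ws d') :=
  fpreim ffF (iso_inv (wi d') ∘ h ∘ wi d).

Fact winv_lin (d d' : D) : linear (@wmap d d').
Proof.
move=> a f g; apply: (fmap_inj ffF); rewrite fmap_lin !fmap_fpreim.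
by rewrite compDZr compDZl.
Qed.

Fact winv1 (d : D) : wmap (idm d) = idm (ws d).
Proof.
by apply: (fmap_inj ffF); rewrite fmap_fpreim fmap1 mcompm1 iso_homK.
Qed.

Fact winvM (d d' d'' : D) (g : hom d' d'') (f : hom d d') :
  wmap (g ∘ f) = wmap g ∘ wmap f.
Proof.
apply: (fmap_inj ffF); rewrite fmapM !fmap_fpreim -!mcompA; congr (_ ∘ (_ ∘ _)).
by rewrite !mcompA iso_invK mcomp1m.
Qed.

Definition winv : linFun D C := LinFun winv_lin winv1 winvM.

Lemma weak_equiv_lin_equivalent : lin_equivalent C D.
Proof.
exists F, winv; split.
  have wK x : fpreim ffF (iso_inv (wi (F x))) ∘ fpreim ffF (wi (F x)) = idm _.
    by apply: (fmap_inj ffF); rewrite fmapM fmap1 !fmap_fpreim iso_homK.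
  have wK' x : fpreim ffF (wi (F x)) ∘ fpreim ffF (iso_inv (wi (F x))) = idm _.
    by apply: (fmap_inj ffF); rewrite fmapM fmap1 !fmap_fpreim iso_invK.
  exists (fun x => Iso (wK x) (wK' x)) => x y f /=.
  apply: (fmap_inj ffF); rewrite !fmapM !fmap_fpreim.
  by rewrite !mcompA iso_invK mcomp1m.
exists wi => x y f /=; rewrite fmap_fpreim.
by rewrite !mcompA iso_invK mcomp1m.
Qed.

End Inverse.
End WeakEquiv.

Section Transfer.
Variables (k : fieldType) (C D : linCat k) (F : linFun C D).
Hypothesis weF : weak_equiv F.
Let ffF : fully_faithful F. Proof. by case: weF. Qed.

Lemma weak_equiv_additive : additive_cat D -> additive_cat C.
Proof.
move=> addD n X; have [s [i [p [pi pi0 ip]]]] := addD n (fun j => F (X j)).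
have [x [v]] := weF.2 s; exists x.
exists (fun j => fpreim ffF (iso_inv v ∘ i j)), (fun j => fpreim ffF (p j ∘ v)).
split=> [j | j l jl |]; apply: (fmap_inj ffF).
- rewrite fmapM !fmap_fpreim fmap1 -mcompA [v ∘ _]mcompA iso_invK mcomp1m.
  exact: pi.
- rewrite fmapM !fmap_fpreim fmap0 -mcompA [v ∘ _]mcompA iso_invK mcomp1m.
  exact: pi0.
- rewrite fmap_sum fmap1 -(iso_homK v) -[iso_hom v in RHS]mcomp1m -ip.
  rewrite mcomp_suml mcomp_sumr; apply: eq_bigr => j _.
  by rewrite fmapM !fmap_fpreim !mcompA.
Qed.

Lemma weak_equiv_split : idempotents_split D -> idempotents_split C.
Proof.
move=> splD x e ee; have [|S] := splD _ (fmap F e); first by rewrite -fmapM ee.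
have [y [v]] := weF.2 S; split.
apply: (@Splitting _ _ _ y (fpreim ffF (sp_in S ∘ v))
  (fpreim ffF (iso_inv v ∘ sp_pr S))); apply: (fmap_inj ffF).
  rewrite fmapM !fmap_fpreim fmap1 -mcompA [sp_pr S ∘ _]mcompA sp_prin mcomp1m.
  exact: iso_homK.
rewrite fmapM !fmap_fpreim -mcompA [v ∘ _]mcompA iso_invK mcomp1m.
exact: sp_inpr.
Qed.

End Transfer.

Section CompEquiv.
Variables (k : fieldType) (C D E : linCat k) (G : linFun D E) (F : linFun C D).

Lemma comp_fully_faithful :
  fully_faithful G -> fully_faithful F -> fully_faithful (comp_fun G F).
Proof.
move=> ffG ffF x y; split=> [f g /= /(fmap_inj ffG)/(fmap_inj ffF)//|h].
by exists (fpreim ffF (fpreim ffG h)); rewrite /= !fmap_fpreim.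
Qed.

End CompEquiv.

Lemma finite_catP (k : fieldType) (C : linCat k) :
  finite_cat C <-> exists (A : fdAlg k) (F : linFun C (rep_cat A)), weak_equiv F.
Proof.
split=> [[A /lin_equivalent_weak h]|[A [F h]]]; first by exists A.
by exists A; exact: weak_equiv_lin_equivalent h.
Qed.

(** * Representations of a finite dimensional algebra *)

HB.instance Definition _ (k : fieldType) (A : fdAlg k) (a : A) :=
  GRing.isLinear.Build k A A _ (@alg_mul k A a) (@alg_mul_linr k A a).

Section Rep.
Variables (k : fieldType) (A : fdAlg k).
Implicit Types U V : rep_cat A.

HB.instance Definition _ (U : rep A) :=
  GRing.isLinear.Build k A 'M[k]_(rep_dim U) _ (@rep_mx k A U) (@rep_lin k A U).

Lemma rep_hom_intertwines (U V : rep_cat A) (f : hom U V) (a : A) :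
  rep_hom_mx f *m rep_mx U a = rep_mx V a *m rep_hom_mx f.
Proof. by have /asboolP := rep_homP f; apply. Qed.

Definition mk_rep_hom (U V : rep A) (f : 'M[k]_(rep_dim V, rep_dim U))
    (hf : forall a, f *m U a = V a *m f) : @hom (rep_cat A) U V :=
  RepHom (introT (asboolP _) hf).

Lemma rep_homP_eq (U V : rep_cat A) (f g : hom U V) :
  rep_hom_mx f = rep_hom_mx g -> f = g.
Proof. by move=> fg; apply: val_inj. Qed.

Lemma rep_hom_sum (U V : rep_cat A) (I : finType) (f : I -> hom U V) :
  rep_hom_mx (\sum_j f j) = \sum_j rep_hom_mx (f j).
Proof. by apply: (big_morph (@rep_hom_mx k A U V)). Qed.

Section DirectSum.
Variables (n : nat) (U : 'I_n -> rep A) (s : nat).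
Variables (inj : forall j, 'M[k]_(s, rep_dim (U j))).
Variables (prj : forall j, 'M[k]_(rep_dim (U j), s)).
Hypothesis prj_inj : forall j, prj j *m inj j = 1%:M.
Hypothesis prj_inj0 : forall j l, j != l -> prj j *m inj l = 0.
Hypothesis sum_inj_prj : \sum_j inj j *m prj j = 1%:M.

Let sum_mx a := \sum_j inj j *m U j a *m prj j.

Let sum_mx_inj a j : sum_mx a *m inj j = inj j *m U j a.
Proof.
rewrite mulmx_suml (bigD1 j) //= -mulmxA prj_inj mulmx1 big1 ?addr0 // => l lj.
by rewrite -mulmxA prj_inj0 // mulmx0.
Qed.

Let prj_sum_mx a j : prj j *m sum_mx a = U j a *m prj j.
Proof.
rewrite mulmx_sumr (bigD1 j) //= !mulmxA prj_inj mul1mx big1 ?addr0 // => l lj.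
by rewrite !mulmxA prj_inj0 ?mul0mx // eq_sym.
Qed.

Fact sum_mx_lin : linear sum_mx.
Proof.
move=> c a b; rewrite /sum_mx scaler_sumr -big_split; apply: eq_bigr => j _ /=.
by rewrite linearP mulmxDr mulmxDl -scalemxAr -scalemxAl.
Qed.

Fact sum_mx1 : sum_mx (alg_one A) = 1%:M.
Proof. by rewrite -sum_inj_prj; apply: eq_bigr => j _; rewrite rep1 mulmx1. Qed.

Fact sum_mxM a b : sum_mx (alg_mul a b) = sum_mx a *m sum_mx b.
Proof.
rewrite {3}/sum_mx mulmx_sumr; apply: eq_bigr => j _.
by rewrite !mulmxA sum_mx_inj repM mulmxA.
Qed.

Let sum_rep : rep A := Rep sum_mx_lin sum_mx1 sum_mxM.

Lemma rep_biproduct : @is_biproduct (rep_cat A) n U sum_rep.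
Proof.
exists (fun j => @mk_rep_hom (U j) sum_rep (inj j) (fun a => esym (sum_mx_inj a j))).
exists (fun j => @mk_rep_hom sum_rep (U j) (prj j) (fun a => prj_sum_mx a j)).
split=> [j | j l jl |]; apply: rep_homP_eq.
- exact: prj_inj.
- exact: prj_inj0.
- by rewrite rep_hom_sum; exact: sum_inj_prj.
Qed.

End DirectSum.

Lemma rep_additive : additive_cat (rep_cat A).
Proof.
move=> n U; pose p j := rep_dim (U j).
pose inj j : 'M[k]_(\sum_j p j, p j) := submxrow 1%:M j.
pose prj j : 'M[k]_(p j, \sum_j p j) := submxcol 1%:M j.
have prj_inj j l : prj j *m inj l = submxblock (\mxdiag_i 1%:M) j l.
  by rewrite /prj /inj mul_submxrow mulmx1 -submxblockEv mxdiagZ.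
eexists; apply: (@rep_biproduct n U _ inj prj) => [j | j l jl |].
- by rewrite prj_inj submxblock_diag.
- by rewrite prj_inj /mxdiag mxblockK (negPf jl).
- by rewrite -mul_mxrow_mxcol submxrowK submxcolK mulmx1.
Qed.

Lemma idempotent_mx_split m (e : 'M[k]_m) : e *m e = e ->
  exists r (C : 'M_(m, r)) (R : 'M_(r, m)), R *m C = 1%:M /\ C *m R = e.
Proof.
move=> ee; exists (\rank e), (col_base e), (row_base e).
split; last exact: mulmx_base.
apply: (row_full_inj (col_base_full e)).
apply: (row_free_inj (row_base_free e)).
by rewrite /= mulmx1 mulmxA mulmx_base -mulmxA mulmx_base.
Qed.

Lemma rep_split : idempotents_split (rep_cat A).
Proof.
move=> U e /(congr1 (@rep_hom_mx k A U U)) /= /idempotent_mx_split.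
case=> r [C [R [RC CR]]].
have eC : rep_hom_mx e *m C = C by rewrite -CR -mulmxA RC mulmx1.
have Re : R *m rep_hom_mx e = R by rewrite -CR mulmxA RC mul1mx.
pose W a := R *m U a *m C.
have CW a : C *m W a = U a *m C.
  by rewrite /W !mulmxA CR rep_hom_intertwines -mulmxA eC.
have WR a : R *m U a = W a *m R.
  by rewrite /W -mulmxA CR -mulmxA -rep_hom_intertwines mulmxA Re.
have W_lin : linear W.
  by move=> c a b; rewrite /W linearP mulmxDr mulmxDl -scalemxAr -scalemxAl.
have W1 : W (alg_one A) = 1%:M by rewrite /W rep1 mulmx1.
have WM a b : W (alg_mul a b) = W a *m W b.
  by rewrite {1}/W repM !mulmxA WR -!mulmxA.
pose S : rep A := Rep W_lin W1 WM.
split; apply: (@Splitting (rep_cat A) U e S (@mk_rep_hom S U C CW)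
  (@mk_rep_hom U S R WR)); exact: rep_homP_eq.
Qed.

(** ** The regular representation *)

Definition coord_col (a : A) : 'cV[k]_(dim A) := (v2r a)^T.

Lemma coord_colK : cancel coord_col (fun v => r2v v^T).
Proof. by move=> a; rewrite /coord_col trmxK v2rK. Qed.

Lemma coord_col_ext m (f g : 'M[k]_(m, dim A)) :
  (forall a, f *m coord_col a = g *m coord_col a) -> f = g.
Proof.
move=> fg; apply: trmx_inj; apply/row_matrixP => i; rewrite !rowE.
apply: trmx_inj; rewrite !trmx_mul !trmxK.
by have := fg (r2v (delta_mx 0 i)); rewrite /coord_col r2vK.
Qed.

Definition coord_mx m (f : A -> 'cV[k]_m) : 'M[k]_(m, dim A) :=
  (lin1_mx (fun r : 'rV[k]_(dim A) => (f (r2v r))^T))^T.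

Lemma coord_mxE m (f : {linear A -> 'cV[k]_m}) a : coord_mx f *m coord_col a = f a.
Proof.
have flin : linear (fun r : 'rV[k]_(dim A) => (f (r2v r))^T).
  by move=> c u v; rewrite !linearP.
pose g : {linear 'rV[k]_(dim A) -> 'rV[k]_m} :=
  HB.pack (fun r : 'rV[k]_(dim A) => (f (r2v r))^T)
   (GRing.isLinear.Build k _ _ _ _ flin).
by rewrite /coord_mx /coord_col -trmx_mul (mul_rV_lin1 g) trmxK v2rK.
Qed.

End Rep.

Section Regular.
Variables (k : fieldType) (A : fdAlg k).

Definition reg_mx (a : A) : 'M[k]_(dim A) := coord_mx (fun b => coord_col (alg_mul a b)).

Fact coord_col_is_linear : linear (@coord_col k A).
Proof. by move=> c a b; rewrite /coord_col !linearP. Qed.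
HB.instance Definition _ :=
  GRing.isLinear.Build k A 'cV[k]_(dim A) _ (@coord_col k A) coord_col_is_linear.

Lemma reg_mxE a b : reg_mx a *m coord_col b = coord_col (alg_mul a b).
Proof.
have flin : linear (fun b => coord_col (alg_mul a b)) by move=> c u v; rewrite !linearP.
exact: (@coord_mxE k A _ (HB.pack (fun b => coord_col (alg_mul a b))
   (GRing.isLinear.Build k _ _ _ _ flin))).
Qed.

Fact reg_lin : linear reg_mx.
Proof.
move=> c a b; apply: coord_col_ext => d.
by rewrite mulmxDl -scalemxAl !reg_mxE -linearP (alg_mul_linl d).
Qed.

Fact reg1 : reg_mx (alg_one A) = 1%:M.
Proof. by apply: coord_col_ext => a; rewrite reg_mxE alg_mul1l mul1mx. Qed.

Fact regM a b : reg_mx (alg_mul a b) = reg_mx a *m reg_mx b.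
Proof. by apply: coord_col_ext => d; rewrite -mulmxA !reg_mxE alg_mulA. Qed.

Definition reg_rep : rep A := Rep reg_lin reg1 regM.

Lemma reg_mx_inj : injective reg_mx.
Proof.
move=> a b /(congr1 (fun M => M *m coord_col (alg_one A))).
by rewrite !reg_mxE !alg_mul1r => /(can_inj (@coord_colK k A)).
Qed.

(** A homomorphism out of the regular representation amounts to a vector, the
    image of [1]; this is what makes naturality along all such homomorphisms
    strong enough to pin down a natural endomorphism. *)
Section OrbitMap.
Variables (U : rep A) (w : 'cV[k]_(rep_dim U)).

Definition orbit_mx : 'M[k]_(rep_dim U, dim A) := coord_mx (fun a => U a *m w).

Lemma orbit_mxE a : orbit_mx *m coord_col a = U a *m w.
Proof.
have flin : linear (fun a => U a *m w).
  by move=> c u v; rewrite linearP mulmxDl -scalemxAl.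
exact: (@coord_mxE k A _ (HB.pack (fun a => U a *m w)
   (GRing.isLinear.Build k _ _ _ _ flin))).
Qed.

Lemma orbit_intertwines a : orbit_mx *m reg_rep a = U a *m orbit_mx.
Proof.
apply: coord_col_ext => b.
by rewrite -!mulmxA orbit_mxE reg_mxE orbit_mxE repM mulmxA.
Qed.

Definition orbit_hom : @hom (rep_cat A) reg_rep U := mk_rep_hom orbit_intertwines.

End OrbitMap.

End Regular.

Definition natural_endo (k : fieldType) (C : linCat k) (e : forall x : C, hom x x) :=
  forall (x y : C) (f : hom x y), e y ∘ f = f ∘ e x.

(** Take for [z] the value at [1] of the endomorphism of the regular
    representation induced by [e]. A vector [w] of [F x] is the image of [1]
    under the homomorphism [a |-> a w], and naturality along it says that [e x]
    sends [w] to [z w]. *)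
Lemma natural_endo_scalar (k : fieldType) (A : fdAlg k) (C : linCat k)
    (F : linFun C (rep_cat A)) (e : forall x : C, hom x x) :
  weak_equiv F -> natural_endo e ->
  exists z : A, forall x, rep_hom_mx (fmap F (e x)) = F x z.
Proof.
move=> [ffF esF] e_nat; have [x0 [v]] := esF (reg_rep A).
have [E EE] : exists E : 'M_(dim A), E = rep_hom_mx (v ∘ fmap F (e x0) ∘ iso_inv v).
  by eexists.
pose z := @r2v k A (E *m coord_col (alg_one A))^T.
have zE : coord_col z = E *m coord_col (alg_one A) by rewrite /coord_col r2vK trmxK.
exists z => x.
apply/trmx_inj/row_matrixP => i; rewrite !rowE.
apply: trmx_inj; rewrite !trmx_mul !trmxK.
set w := trmx _.
have: rep_hom_mx (fmap F (e x)) *m orbit_mx (U := F x) w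
    = orbit_mx (U := F x) w *m E.
  have := congr1 (fun g => fmap F g) (e_nat _ _ (fpreim ffF (orbit_hom (U := F x) w ∘ v))).
  rewrite !fmapM fmap_fpreim.
  move/(congr1 (fun f => f ∘ iso_inv v)).
  rewrite -!mcompA iso_invK mcompm1 => /(congr1 (@rep_hom_mx _ _ _ _)) /= ->.
  by rewrite EE /= !mulmxA.
move/(congr1 (fun M => M *m coord_col (alg_one A))).
rewrite -!mulmxA orbit_mxE rep1 mul1mx => ->.
by rewrite -zE orbit_mxE.
Qed.

(** The inclusions of a corner [zA] into [A] and of a factor into a product of
    algebras do not preserve the unit, but one can restrict along them those
    representations on which the image of the unit acts as the identity. *)
Section Pull.
Variables (k : fieldType) (A B : fdAlg k) (phi : B -> A).
Hypothesis phi_lin : linear phi.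
Hypothesis phiM : forall a b, phi (alg_mul a b) = alg_mul (phi a) (phi b).
Variable U : rep A.
Hypothesis phi1 : U (phi (alg_one B)) = 1%:M.

Fact pull_lin : linear (fun b => U (phi b)).
Proof. by move=> c a b; rewrite phi_lin linearP. Qed.

Fact pullM a b : U (phi (alg_mul a b)) = U (phi a) *m U (phi b).
Proof. by rewrite phiM repM. Qed.

Definition rep_pull : rep B := Rep pull_lin phi1 pullM.

End Pull.

(** * The corner algebra of a central idempotent *)

(** For central [z] the corner is [zA], and its representations are those of [A]
    on which [z] acts as the identity. *)
Section Corner.
Variables (k : fieldType) (A : fdAlg k) (z : A).
Hypothesis zz : alg_mul z z = z.
Hypothesis zC : forall a, alg_mul z a = alg_mul a z.

Let zl : 'End(A) := linfun (alg_mul z).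
Let zA := subvs_of (limg zl).

Let zl_mem a : alg_mul z a \in limg zl.
Proof. by have := memv_img zl (memvf a); rewrite lfunE. Qed.

Let zval (a : zA) : alg_mul z (vsval a) = vsval a.
Proof.
by have /memv_imgP[b _ ->] := subvsP a; rewrite lfunE /= alg_mulA zz.
Qed.

Let cmul (a b : zA) : zA := vsproj _ (alg_mul (vsval a) (vsval b)).

Lemma corner_valM a b : vsval (cmul a b) = alg_mul (vsval a) (vsval b).
Proof. by rewrite vsprojK // -zval -alg_mulA zl_mem. Qed.

Let cone : zA := vsproj _ z.

Lemma corner_val1 : vsval cone = z.
Proof. by rewrite vsprojK // -zz zl_mem. Qed.

Fact corner_mulA : associative cmul.
Proof. by move=> a b c; apply: subvs_inj; rewrite !corner_valM alg_mulA. Qed.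
Fact corner_mul1l : left_id cone cmul.
Proof. by move=> a; apply: subvs_inj; rewrite corner_valM corner_val1 zval. Qed.
Fact corner_mul1r : right_id cone cmul.
Proof. by move=> a; apply: subvs_inj; rewrite corner_valM corner_val1 -zC zval. Qed.
Fact corner_mul_linl b : linear (cmul^~ b).
Proof.
move=> c a a'; apply: subvs_inj.
by rewrite linearP /= !corner_valM linearP (alg_mul_linl (vsval b)).
Qed.
Fact corner_mul_linr a : linear (cmul a).
Proof.
move=> c b b'; apply: subvs_inj.
by rewrite linearP /= !corner_valM !linearP.
Qed.

Definition corner_alg : fdAlg k :=
  @FdAlg k zA cone cmul corner_mulA corner_mul1l corner_mul1r
    corner_mul_linl corner_mul_linr.

Definition corner_val (a : corner_alg) : A := vsval a.
Definition corner_proj (a : A) : corner_alg := vsproj (limg zl) (alg_mul z a).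

Lemma corner_val_lin : linear corner_val.
Proof. by move=> c a b; rewrite /corner_val linearP. Qed.

Lemma corner_projK a : corner_val (corner_proj a) = alg_mul z a.
Proof. by rewrite /corner_val vsprojK ?zl_mem. Qed.

Lemma corner_valK a : corner_proj (corner_val a) = a.
Proof. by apply: subvs_inj; rewrite -/(corner_val _) corner_projK zval. Qed.

Lemma corner_proj_lin : linear corner_proj.
Proof. by move=> c a b; rewrite /corner_proj !linearP. Qed.

Lemma corner_projM a b :
  corner_proj (alg_mul a b) = alg_mul (corner_proj a) (corner_proj b).
Proof.
apply: subvs_inj; rewrite corner_valM -!/(corner_val _) !corner_projK.
rewrite (zC a) -[in RHS]alg_mulA [alg_mul z (alg_mul z b)]alg_mulA zz.
by rewrite alg_mulA zC alg_mulA.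
Qed.

Lemma corner_proj1 : corner_proj (alg_one A) = alg_one corner_alg.
Proof. by rewrite /corner_proj alg_mul1r. Qed.

End Corner.

(** * Finite products of algebras *)

Lemma alg_mul0l (k : fieldType) (A : fdAlg k) (b : A) : alg_mul 0 b = 0.
Proof.
have := alg_mul_linl b (-1) 0 0.
by rewrite scaler0 addr0 => ->; rewrite scaleN1r addNr.
Qed.

(** Coordinates are used as carrier because the algebras [A j] live on different
    types: block row matrices [\mxrow_j] concatenate their coordinate vectors. *)
Section ProdAlg.
Variables (k : fieldType) (n : nat) (A : 'I_n -> fdAlg k).

Let pA := 'rV[k]_(\sum_j dim (A j)).

Definition pa_proj j (v : pA) : A j := r2v (submxrow v j).
Definition pa_pack (a : forall j, A j) : pA := \mxrow_j v2r (a j).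

Lemma pa_packK a j : pa_proj j (pa_pack a) = a j.
Proof. by rewrite /pa_proj /pa_pack mxrowK v2rK. Qed.

Lemma pa_ext (v w : pA) : (forall j, pa_proj j v = pa_proj j w) -> v = w.
Proof.
move=> vw; rewrite -[v]submxrowK -[w]submxrowK; apply: eq_mxrow => j.
exact: r2v_inj (vw j).
Qed.

Lemma pa_proj_lin j : linear (pa_proj j).
Proof.
move=> c v w; rewrite /pa_proj -linearP /=; congr r2v.
by apply/matrixP => i l; rewrite !mxE.
Qed.

Let pmul (v w : pA) := pa_pack (fun j => alg_mul (pa_proj j v) (pa_proj j w)).
Let pone := pa_pack (fun j => alg_one (A j)).

Fact pa_mulA : associative pmul.
Proof. by move=> a b c; apply: pa_ext => j; rewrite !pa_packK alg_mulA. Qed.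
Fact pa_mul1l : left_id pone pmul.
Proof. by move=> a; apply: pa_ext => j; rewrite !pa_packK alg_mul1l. Qed.
Fact pa_mul1r : right_id pone pmul.
Proof. by move=> a; apply: pa_ext => j; rewrite !pa_packK alg_mul1r. Qed.
Fact pa_mul_linl b : linear (pmul^~ b).
Proof.
move=> c a a'; apply: pa_ext => j.
by rewrite pa_proj_lin !pa_packK pa_proj_lin (alg_mul_linl (pa_proj j b)).
Qed.
Fact pa_mul_linr a : linear (pmul a).
Proof.
move=> c b b'; apply: pa_ext => j.
by rewrite pa_proj_lin !pa_packK pa_proj_lin linearP.
Qed.

Definition prod_alg : fdAlg k :=
  @FdAlg k pA pone pmul pa_mulA pa_mul1l pa_mul1r pa_mul_linl pa_mul_linr.

Definition pa_in j (a : A j) : prod_alg := v2r a *m submxcol 1%:M j.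

Lemma pa_inK j (a : A j) : pa_proj j (pa_in a) = a.
Proof.
rewrite /pa_proj /pa_in -mul_submxrow -submxblockEv -mxdiagZ submxblock_diag.
by rewrite mulmx1 v2rK.
Qed.

Lemma pa_in0 j (a : A j) l : j != l -> pa_proj l (pa_in a) = 0.
Proof.
move=> /negPf jl; rewrite /pa_proj /pa_in -mul_submxrow -submxblockEv -mxdiagZ.
by rewrite /mxdiag mxblockK jl mulmx0 linear0.
Qed.

Lemma pa_proj_linear j : linear (pa_proj j : prod_alg -> A j).
Proof. exact: pa_proj_lin. Qed.

Lemma pa_in00 j : @pa_in j 0 = 0.
Proof. by rewrite /pa_in linear0 mul0mx. Qed.

Lemma pa_in_lin j : linear (@pa_in j).
Proof. by move=> c a b; rewrite /pa_in linearP mulmxDl -scalemxAl. Qed.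

Lemma pa_projM j (v w : prod_alg) :
  pa_proj j (alg_mul v w) = alg_mul (pa_proj j v) (pa_proj j w).
Proof. exact: pa_packK. Qed.

Lemma pa_proj1 j : pa_proj j (alg_one prod_alg) = alg_one (A j).
Proof. exact: pa_packK. Qed.

Lemma pa_in_projl j (v : prod_alg) :
  alg_mul (pa_in (alg_one (A j))) v = pa_in (pa_proj j v).
Proof.
apply: pa_ext => l; rewrite pa_projM; have [<-|jl] := eqVneq j l.
  by rewrite !pa_inK alg_mul1l.
by rewrite !pa_in0 // alg_mul0l.
Qed.

Lemma pa_in_projr j (v : prod_alg) :
  alg_mul v (pa_in (alg_one (A j))) = pa_in (pa_proj j v).
Proof.
apply: pa_ext => l; rewrite pa_projM; have [<-|jl] := eqVneq j l.
  by rewrite !pa_inK alg_mul1r.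
by rewrite !pa_in0 // linear0.
Qed.

Lemma pa_inM j (a b : A j) : pa_in (alg_mul a b) = alg_mul (pa_in a) (pa_in b) :> prod_alg.
Proof.
apply: pa_ext => l; rewrite pa_projM; have [<-|jl] := eqVneq j l.
  by rewrite !pa_inK.
by rewrite !pa_in0 // linear0.
Qed.

Lemma pa_sum1 : \sum_j pa_in (alg_one (A j)) = alg_one prod_alg.
Proof.
apply: pa_ext => l.
pose f : {linear prod_alg -> A l} :=
  HB.pack (@pa_proj l) (GRing.isLinear.Build k _ _ _ _ (@pa_proj_lin l)).
rewrite -[LHS]/(f _) linear_sum (bigD1 l) //= big1 ?addr0 => [|j jl].
  by rewrite pa_inK pa_proj1.
by rewrite pa_in0.
Qed.

End ProdAlg.

(** * Full subcategories and blocks of a linear category *)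

Section FullLin.
Variables (k : fieldType) (C : linCat k) (T : Type) (phi : T -> C).

Definition full_preadd : preaddCat :=
  @PreaddCat T (fun x y => hom (phi x) (phi y))
    (fun x y => @hom_zmod C (phi x) (phi y))
    (fun x => idm (phi x)) (fun x y z g f => g ∘ f)
    (fun x y => @mcomp1m C _ _) (fun x y => @mcompm1 C _ _)
    (fun w x y z => @mcompA C _ _ _ _)
    (fun x y z => @mcompDl C _ _ _) (fun x y z => @mcompDr C _ _ _).

Definition full_lin : linCat k :=
  @LinCat k full_preadd (fun x y => @lin_scale k C (phi x) (phi y))
    (fun x y z => @mcompZl k C _ _ _) (fun x y z => @mcompZr k C _ _ _).

Definition full_incl : linFun full_lin C :=
  @LinFun k full_lin C phi (fun x y f => f) (fun x y a f g => erefl)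
    (fun x => erefl) (fun x y z g f => erefl).

End FullLin.

(** For [e] an idempotent of the center of the category, this is the union of
    blocks cut out by [e]. *)
Definition block (k : fieldType) (C : linCat k) (e : forall x : C, hom x x) :=
  full_lin (fun x : {x : C | e x = idm x} => sval x).

Section BlockFinite.
Variables (k : fieldType) (C : linCat k) (e : forall x : C, hom x x).
Hypothesis e_nat : natural_endo e.
Hypothesis ee : forall x, e x ∘ e x = e x.

(** If [C] is [Rep A], then [e] is multiplication by a central idempotent [z] of
    [A], and the block is the category of representations of [zA]. *)
Lemma block_finite : finite_cat C -> finite_cat (block e).
Proof.
move=> /finite_catP[A [F weF]]; have [ffF esF] := weF.
have [z zP] := natural_endo_scalar weF e_nat.
have [x0 [v]] := esF (reg_rep A).
(* [E] is [e] transported to the regular representation; it is given by [z],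
   so [z] is idempotent as [E] is, and central as [E] is a homomorphism. *)
have [E [EE zreg]] : exists E : @hom (rep_cat A) (reg_rep A) (reg_rep A),
    E ∘ E = E /\ reg_mx z = rep_hom_mx E.
  exists (v ∘ fmap F (e x0) ∘ iso_inv v); split.
    rewrite -!mcompA; congr (_ ∘ _).
    by rewrite !mcompA -[_ ∘ iso_inv v ∘ v]mcompA iso_homK mcompm1 -fmapM ee.
  rewrite /= zP; have /= -> := rep_hom_intertwines v z; rewrite -mulmxA.
  by have /(congr1 (@rep_hom_mx _ _ _ _))/= -> := iso_invK v; rewrite mulmx1.
have zz : alg_mul z z = z.
  by apply: reg_mx_inj; rewrite regM zreg -{3}EE.
have zC a : alg_mul z a = alg_mul a z.
  by apply: reg_mx_inj; rewrite !regM zreg; exact: (rep_hom_intertwines E a).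
have Fz1 (x : block e) : F (sval x) z = 1%:M.
  by have <- := zP (sval x); rewrite (svalP x) fmap1.
have z1 (x : block e) : F (sval x) (corner_val (alg_one (corner_alg zz zC))) = 1%:M.
  by rewrite [corner_val _]corner_val1.
pose G0 (x : block e) : rep_cat (corner_alg zz zC) :=
  rep_pull (@corner_val_lin _ _ z zz zC) (corner_valM zz) (z1 x).
pose Gm (x y : block e) (f : hom x y) : hom (G0 x) (G0 y) :=
  @mk_rep_hom _ _ (G0 x) (G0 y) (rep_hom_mx (fmap F f))
    (fun a => rep_hom_intertwines (fmap F f) (corner_val a)).
have Gl x y : linear (@Gm x y).
  move=> a f g; apply: rep_homP_eq => /=.
  by rewrite (fmap_lin F a f g).
have G1 x : Gm _ _ (idm x) = idm (G0 x).
  by apply: rep_homP_eq; rewrite /= fmap1.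
have GM x y w (g : hom y w) (f : hom x y) : Gm _ _ (g ∘ f) = Gm _ _ g ∘ Gm _ _ f.
  by apply: rep_homP_eq; rewrite /= (fmapM F g f).
apply/finite_catP; exists (corner_alg zz zC), (LinFun Gl G1 GM); split.
  move=> x y; split=> [f g /(congr1 (@rep_hom_mx _ _ _ _)) /= fg|h].
    by apply: (fmap_inj ffF); exact: rep_homP_eq.
  have hz a : rep_hom_mx h *m F (sval x) a = F (sval y) a *m rep_hom_mx h.
    have hc := rep_hom_intertwines h (corner_proj zz zC a).
    have Fz (t : block e) : F (sval t) (corner_val (corner_proj zz zC a)) = F (sval t) a.
      by rewrite corner_projK repM Fz1 mul1mx.
    by rewrite -(Fz x) -(Fz y); exact: hc.
  exists (fpreim ffF (mk_rep_hom hz)); apply: rep_homP_eq => /=.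
  by rewrite (fmap_fpreim ffF).
move=> V.
have V1 : V (corner_proj zz zC (alg_one A)) = 1%:M by rewrite corner_proj1 rep1.
pose U := rep_pull (@corner_proj_lin _ _ z zz zC) (corner_projM zz zC) V1.
have [x [u]] := esF U.
have ex : e x = idm x.
  apply: (fmap_inj ffF); rewrite fmap1 -[LHS]mcomp1m -(iso_homK u) -mcompA.
  congr (_ ∘ _); apply: rep_homP_eq; rewrite /= zP.
  have /= -> := rep_hom_intertwines u z.
  suff -> : corner_proj zz zC z = corner_proj zz zC (alg_one A) by rewrite V1 mul1mx.
  by apply: subvs_inj; rewrite -!/(corner_val _) !corner_projK alg_mul1r.
exists (exist _ x ex); split.
have uh (a : corner_alg zz zC) :
    rep_hom_mx (iso_hom u) *m F x (corner_val a) = V a *m rep_hom_mx (iso_hom u).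
  by have /= -> := rep_hom_intertwines u (corner_val a); rewrite corner_valK.
have uh' (a : corner_alg zz zC) :
    rep_hom_mx (iso_inv u) *m V a = F x (corner_val a) *m rep_hom_mx (iso_inv u).
  have /= <- := rep_hom_intertwines (iso_inv u) (corner_val a).
  by rewrite corner_valK.
apply: (@Iso _ (G0 (exist _ x ex)) V
  (@mk_rep_hom _ _ (G0 (exist _ x ex)) V (rep_hom_mx (iso_hom u)) uh)
  (@mk_rep_hom _ _ V (G0 (exist _ x ex)) (rep_hom_mx (iso_inv u)) uh'));
  apply: rep_homP_eq.
- by have /(congr1 (@rep_hom_mx _ _ _ _)) := iso_homK u.
- by have /(congr1 (@rep_hom_mx _ _ _ _)) := iso_invK u.
Qed.

End BlockFinite.

(** * Finite products of linear categories *)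

Section ProdHom.
Variables (k : fieldType) (n : nat) (C : 'I_n -> linCat k).

Definition prod_ob := forall j, C j.
Definition prod_hom (x y : prod_ob) := forall j, hom (x j) (y j).

Lemma prod_homP (x y : prod_ob) (f g : prod_hom x y) : (forall j, f j = g j) -> f = g.
Proof. exact: functional_extensionality_dep. Qed.

Variables x y : prod_ob.
HB.instance Definition _ := gen_eqMixin (prod_hom x y).
HB.instance Definition _ := gen_choiceMixin (prod_hom x y).

Let add (f g : prod_hom x y) : prod_hom x y := fun j => f j + g j.
Let opp (f : prod_hom x y) : prod_hom x y := fun j => - f j.

Fact prod_hom_addA : associative add.
Proof. by move=> f g h; apply: prod_homP => j; rewrite /add addrA. Qed.
Fact prod_hom_addC : commutative add.
Proof. by move=> f g; apply: prod_homP => j; rewrite /add addrC. Qed.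
Fact prod_hom_add0 : left_id ((fun j => 0) : prod_hom x y) add.
Proof. by move=> f; apply: prod_homP => j; rewrite /add add0r. Qed.
Fact prod_hom_addN : left_inverse ((fun j => 0) : prod_hom x y) opp add.
Proof. by move=> f; apply: prod_homP => j; rewrite /add /opp addNr. Qed.

HB.instance Definition _ := GRing.isZmodule.Build (prod_hom x y)
  prod_hom_addA prod_hom_addC prod_hom_add0 prod_hom_addN.

Let scale (a : k) (f : prod_hom x y) : prod_hom x y := fun j => a *: f j.

Fact prod_hom_scaleA a b f : scale a (scale b f) = scale (a * b) f.
Proof. by apply: prod_homP => j; rewrite /scale scalerA. Qed.
Fact prod_hom_scale1 : left_id 1 scale.
Proof. by move=> f; apply: prod_homP => j; rewrite /scale scale1r. Qed.
Fact prod_hom_scaleDr : right_distributive scale +%R.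
Proof. by move=> a f g; apply: prod_homP => j; rewrite /scale scalerDr. Qed.
Fact prod_hom_scaleDl f : {morph scale^~ f : a b / a + b}.
Proof. by move=> a b; apply: prod_homP => j; rewrite /scale scalerDl. Qed.

HB.instance Definition _ := GRing.Zmodule_isLmodule.Build k (prod_hom x y)
  prod_hom_scaleA prod_hom_scale1 prod_hom_scaleDr prod_hom_scaleDl.

End ProdHom.

Section ProdLin.
Variables (k : fieldType) (n : nat) (C : 'I_n -> linCat k).

Definition prod_preadd : preaddCat.
Proof.
refine (@PreaddCat (prod_ob C) (@prod_hom k n C)
  (fun x y => GRing.Zmodule.class (prod_hom x y))
  (fun x j => idm (x j)) (fun x y z g f j => g j ∘ f j) _ _ _ _ _).
- by move=> x y f; apply: prod_homP => j; rewrite mcomp1m.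
- by move=> x y f; apply: prod_homP => j; rewrite mcompm1.
- by move=> w x y z h g f; apply: prod_homP => j; rewrite mcompA.
- by move=> x y z f g g'; apply: prod_homP => j; apply: mcompDl.
- by move=> x y z g f f'; apply: prod_homP => j; apply: mcompDr.
Defined.

Definition prod_lin : linCat k.
Proof.
refine (@LinCat k prod_preadd
    (fun x y => GRing.Lmodule.GRing_Nmodule_isLSemiModule_mixin
                  (GRing.Lmodule.class (prod_hom x y))) _ _).
- by move=> x y z a g f; apply: prod_homP => j; apply: mcompZl.
- by move=> x y z a g f; apply: prod_homP => j; apply: mcompZr.
Defined.

Lemma prod_hom_sumE (x y : prod_lin) (I : finType) (f : I -> hom x y) j :
  (\sum_i f i) j = \sum_i f i j.
Proof. exact: (big_morph (fun h : hom x y => h j)). Qed.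

Lemma prod_iso (x y : prod_lin) (u : forall j, iso (x j) (y j)) : iso x y.
Proof.
apply: (@Iso prod_lin x y (fun j => iso_hom (u j)) (fun j => iso_inv (u j))).
  by apply: prod_homP => j; exact: iso_homK.
by apply: prod_homP => j; exact: iso_invK.
Defined.

(** The functor out of the product sends [(x j)] to the direct sum of the
    [J j (x j)]. Orthogonality of the [C j] makes the matrix of a morphism
    between such sums diagonal, whence full faithfulness. *)
Section Glue.
Variables (D : linCat k) (J : forall j, linFun (C j) D).
Hypothesis addD : additive_cat D.
Hypothesis ffJ : forall j, fully_faithful (J j).
Hypothesis orthJ : forall j l (x : C j) (y : C l), j != l ->
  forall h : hom (J j x) (J l y), h = 0.
Hypothesis genJ : forall d : D, exists x : prod_lin,
  is_biproduct (fun j => J j (x j)) d.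

Let B (x : prod_lin) := choose_biprod (fun j => J j (x j)) addD.

Let Gm (x y : prod_lin) (f : hom x y) : hom (B x : D) (B y : D) :=
  copair (B x) (fun j => bp_in (B y) j ∘ fmap (J j) (f j)).

Fact glue_lin (x y : prod_lin) : linear (@Gm x y).
Proof.
move=> a f g; apply: biprod_ext => j; rewrite compDZl !copair_in.
by rewrite fmap_lin compDZr.
Qed.

Fact glue1 (x : prod_lin) : Gm (idm x) = idm (B x : D).
Proof. by apply: biprod_ext => j; rewrite copair_in fmap1 mcompm1 mcomp1m. Qed.

Fact glueM (x y z : prod_lin) (g : hom y z) (f : hom x y) :
  Gm (g ∘ f) = Gm g ∘ Gm f.
Proof.
apply: biprod_ext => j; rewrite -mcompA !copair_in mcompA copair_in.
by rewrite -mcompA -fmapM.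
Qed.

Definition glue : linFun prod_lin D := LinFun glue_lin glue1 glueM.

Lemma glue_weak_equiv : weak_equiv glue.
Proof.
split=> [x y|d].
  split=> [f g fg|h].
    apply: prod_homP => j; apply: (fmap_inj (@ffJ j)).
    have := congr1 (fun h => bp_pr (B y) j ∘ (h ∘ bp_in (B x) j)) fg.
    by rewrite /= !copair_in !mcompA !bp_prin !mcomp1m.
  exists (fun j => fpreim (@ffJ j) (bp_pr (B y) j ∘ h ∘ bp_in (B x) j)).
  apply: biprod_ext => j; rewrite copair_in fmap_fpreim.
  rewrite -[h in RHS]mcomp1m -[idm _](bp_sum (B y)) !mcomp_suml (bigD1 j) //=.
  rewrite big1 ?addr0 ?mcompA // => l lj.
  by rewrite -!mcompA (orthJ _ (bp_pr (B y) l ∘ _)) ?compm0 // eq_sym.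
have [x /biprodP[Bd <-]] := genJ d.
by exists x; exact: biprod_unique.
Qed.

End Glue.
End ProdLin.

Section Inflate.
Variables (k : fieldType) (A B : fdAlg k) (phi : B -> A).
Hypothesis phi_lin : linear phi.
Hypothesis phiM : forall a b, phi (alg_mul a b) = alg_mul (phi a) (phi b).
Hypothesis phi1 : phi (alg_one B) = alg_one A.

Let phiU (U : rep A) : U (phi (alg_one B)) = 1%:M.
Proof. by rewrite phi1 rep1. Qed.

Let infl_ob (U : rep_cat A) : rep_cat B := rep_pull phi_lin phiM (phiU U).

Let infl_map (U V : rep_cat A) (f : hom U V) : hom (infl_ob U) (infl_ob V) :=
  @mk_rep_hom _ _ (infl_ob U) (infl_ob V) (rep_hom_mx f)
    (fun b => rep_hom_intertwines f (phi b)).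

Fact infl_lin U V : linear (@infl_map U V).
Proof. by move=> a f g; apply: rep_homP_eq. Qed.
Fact infl1 U : infl_map (idm U) = idm (infl_ob U).
Proof. exact: rep_homP_eq. Qed.
Fact inflM U V W (g : hom V W) (f : hom U V) :
  infl_map (g ∘ f) = infl_map g ∘ infl_map f.
Proof. exact: rep_homP_eq. Qed.

Definition inflation : linFun (rep_cat A) (rep_cat B) :=
  LinFun infl_lin infl1 inflM.

Lemma inflation_ff : (forall a, exists b, phi b = a) -> fully_faithful inflation.
Proof.
move=> phi_surj U V; split=> [f g /(congr1 (@rep_hom_mx _ _ _ _)) fg|h].
  exact: rep_homP_eq.
have hh a : rep_hom_mx h *m rep_mx U a = rep_mx V a *m rep_hom_mx h.
  by have [b <-] := phi_surj a; exact: (rep_hom_intertwines h b).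
by exists (mk_rep_hom hh); exact: rep_homP_eq.
Qed.

End Inflate.

Section ProdFinite.
Variables (k : fieldType) (n : nat) (C : 'I_n -> linCat k).
Variables (A : 'I_n -> fdAlg k) (F : forall j, linFun (C j) (rep_cat (A j))).
Hypothesis weF : forall j, weak_equiv (F j).

Let P : fdAlg k := prod_alg A.
Let infl j : linFun (rep_cat (A j)) (rep_cat P) :=
  @inflation k (A j) P (@pa_proj k n A j) (@pa_proj_linear k n A j)
    (@pa_projM k n A j) (@pa_proj1 k n A j).

Let infl_ff j : fully_faithful (infl j).
Proof. by apply: inflation_ff => a; exists (pa_in a); exact: pa_inK. Qed.

Let infl_orth j l (U : rep_cat (A j)) (V : rep_cat (A l)) :
  j != l -> forall h : hom (infl j U) (infl l V), h = 0.
Proof.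
move=> jl h; apply: rep_homP_eq.
have /= := rep_hom_intertwines h (pa_in (alg_one (A j))).
by rewrite pa_inK rep1 mulmx1 pa_in0 // linear0 mul0mx.
Qed.

(** The units [d j] of the factors are orthogonal central idempotents of the
    product with sum [1], so they split [U]; on the [j]-th summand the product
    acts through its [j]-th factor. *)
Lemma prod_rep_gen (U : rep_cat P) :
  exists x : prod_lin C, is_biproduct (fun j => infl j (F j (x j))) U.
Proof.
pose d j : P := pa_in (alg_one (A j)).
have dC j (a : P) : rep_mx U (d j) *m rep_mx U a = rep_mx U a *m rep_mx U (d j).
  by rewrite -!repM pa_in_projl pa_in_projr.
pose e j : hom U U := mk_rep_hom (dC j).
have ee j : e j ∘ e j = e j.
  by apply: rep_homP_eq; rewrite /= -repM pa_in_projl pa_inK.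
have e0 j l : j != l -> e j ∘ e l = 0.
  move=> jl; apply: rep_homP_eq; rewrite /= -repM pa_in_projl pa_in0 1?eq_sym //.
  by rewrite pa_in00 linear0.
have e1 : \sum_j e j = idm U.
  by apply: rep_homP_eq; rewrite rep_hom_sum /= -rep1 -pa_sum1 linear_sum.
pose S j := inhabited_witness (rep_split (ee j)).
have /biprodP[BS BSU] := splitting_biprod S e0 e1.
have Sd j : rep_mx (S j : rep_cat P) (d j) = 1%:M.
  have /(congr1 (@rep_hom_mx _ _ _ _)) /= pin := sp_prin (S j).
  have /(congr1 (@rep_hom_mx _ _ _ _)) /= inp := sp_inpr (S j).
  have /= h := rep_hom_intertwines (sp_pr (S j)) (d j).
  rewrite -[LHS]mulmx1 -pin mulmxA -h -inp mulmxA pin mul1mx.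
  exact: pin.
pose V j : rep_cat (A j) := rep_pull (@pa_in_lin k n A j) (@pa_inM k n A j) (Sd j).
have V_S j (a : P) : rep_mx (infl j (V j)) a = rep_mx (S j : rep_cat P) a.
  by rewrite /= -pa_in_projl repM Sd mul1mx.
have iVS j : iso (infl j (V j)) (S j).
  have h1 a : 1%:M *m rep_mx (infl j (V j)) a = rep_mx (S j : rep_cat P) a *m 1%:M.
    by rewrite mul1mx mulmx1; exact: V_S.
  have h2 a : 1%:M *m rep_mx (S j : rep_cat P) a = rep_mx (infl j (V j)) a *m 1%:M.
    by rewrite mul1mx mulmx1; exact: esym (V_S _ _).
  apply: (@Iso (rep_cat P) _ _ (@mk_rep_hom k P (infl j (V j)) (sp_ob (S j)) _ h1)
    (@mk_rep_hom k P (sp_ob (S j)) (infl j (V j)) _ h2)); apply: rep_homP_eq; exact: mulmx1.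
pose x : prod_lin C := fun j => sval (cid ((weF j).2 (V j))).
have u j : iso (F j (x j)) (V j) := inhabited_witness (svalP (cid ((weF j).2 (V j)))).
exists x; rewrite -BSU.
exact: (biprod_iso BS (fun j => comp_iso (iVS j) (fmap_iso (infl j) (u j)))).
Qed.

Lemma prod_finite_of_weak_equiv : finite_cat (prod_lin C).
Proof.
apply/finite_catP; exists P.
exists (glue (fun j => comp_fun (infl j) (F j)) (@rep_additive k P)).
apply: glue_weak_equiv; last exact: prod_rep_gen.
- by move=> j; apply: comp_fully_faithful => //; case: (weF j).
- by move=> j l x y jl h; exact: infl_orth jl h.
Qed.

End ProdFinite.

Lemma prod_finite (k : fieldType) (n : nat) (C : 'I_n -> linCat k) :
  (forall j, finite_cat (C j)) -> finite_cat (prod_lin C).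
Proof.
move=> finC.
pose AF j := cid ((finite_catP (C j)).1 (finC j)).
exact: (@prod_finite_of_weak_equiv k n C (fun j => sval (AF j))
  (fun j => sval (cid (svalP (AF j)))) (fun j => svalP (cid (svalP (AF j))))).
Qed.

(** * Idempotents of the center of a finite category *)

Section FiniteCat.
Variables (k : fieldType) (C : linCat k).
Hypothesis finC : finite_cat C.

Lemma finite_additive : additive_cat C.
Proof.
have /finite_catP[A [F weF]] := finC.
exact: weak_equiv_additive weF (@rep_additive k A).
Qed.

Lemma finite_split : idempotents_split C.
Proof.
have /finite_catP[A [F weF]] := finC.
exact: weak_equiv_split weF (@rep_split k A).
Qed.

(** For [C] equivalent to [Rep A], the idempotents are given by orthogonal
    nonzero idempotents of [A]. Those are linearly independent, so that [dim A]
    is a bound. *)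
Lemma orthogonal_natural_bound :
  exists N, forall n (e : 'I_n -> forall x : C, hom x x),
  (forall i, natural_endo (e i)) ->
  (forall i x, e i x ∘ e i x = e i x) ->
  (forall i j, i != j -> forall x, e i x ∘ e j x = 0) ->
  (forall i, exists x, e i x <> 0) -> (n <= N)%N.
Proof.
have /finite_catP[A [F weF]] := finC; have [ffF _] := weF.
exists (dim A) => n e e_nat ee e0 en0.
pose z i := sval (cid (natural_endo_scalar weF (e_nat i))).
have zP i x : rep_hom_mx (fmap F (e i x)) = F x (z i).
  by rewrite /z; case: cid.
pose Z := [tuple z i | i < n].
suff /eqP freeZ : free Z.
  by rewrite -[n](size_tuple Z) -freeZ -dimvf dimvS // subvf.
apply/freeP => c cZ j; have [x ex] := en0 j.
apply/eqP; apply: contra_notT ex => cj.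
have : F x (z j) *m F x (\sum_i c i *: z i) = 0.
  have -> : \sum_i c i *: z i = 0.
    by rewrite -[RHS]cZ; apply: eq_bigr => i _; rewrite -tnth_nth tnth_mktuple.
  by rewrite linear0 mulmx0.
rewrite linear_sum mulmx_sumr (bigD1 j) //= big1 => [|i ij].
  rewrite addr0 linearZ -scalemxAr /= -(zP j x).
  have /(congr1 (fun f => rep_hom_mx (fmap F f))) /= := ee j x.
  rewrite fmapM /= => -> /eqP; rewrite scaler_eq0 (negPf cj) /= => /eqP ej0.
  by apply: (fmap_inj ffF); apply: rep_homP_eq; rewrite ej0 fmap0.
rewrite linearZ -scalemxAr /= -(zP j x) -(zP i x).
have ji : j != i by rewrite eq_sym.
have /(congr1 (fun f => rep_hom_mx (fmap F f))) /= := e0 j i ji x.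
by rewrite fmapM fmap0 /= => ->; rewrite scaler0.
Qed.

End FiniteCat.

Section Primitive.
Variables (C : preaddCat) (x : C).

Definition orthogonal_idempotents n (e : 'I_n -> hom x x) :=
  (forall i, e i ∘ e i = e i) /\ forall i j, i != j -> e i ∘ e j = 0.

Definition primitive (e : hom x x) :=
  e <> 0 /\ forall f, f ∘ f = f -> f ∘ e = f -> e ∘ f = f -> f = 0 \/ f = e.

(** A complete orthogonal family of nonzero idempotents of maximal size
    consists of primitive ones, since a proper subidempotent [f] of [e i] would
    allow to replace [e i] by [f] and [e i - f]. *)
Lemma primitive_decomposition N :
  (forall n (e : 'I_n -> hom x x), orthogonal_idempotents e ->
    (forall i, e i <> 0) -> (n <= N)%N) ->
  exists n (e : 'I_n -> hom x x),
    [/\ orthogonal_idempotents e, \sum_i e i = idm x & forall i, primitive (e i)].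
Proof.
move=> bound.
pose P n := exists e : 'I_n -> hom x x,
  [/\ orthogonal_idempotents e, \sum_i e i = idm x & forall i, e i <> 0].
have exP : exists n, `[< P n >].
  have [x0|x0] := pselect (idm x = 0).
    exists 0%N; apply/asboolP; exists (fun=> 0); split=> [|| [] //].
      by split=> [[]|[]].
    by rewrite big_ord0.
  exists 1%N; apply/asboolP; exists (fun=> idm x); split=> //.
    by split=> [i|i j]; rewrite ?mcomp1m // !ord1.
  by rewrite big_ord1.
have ubP n : `[< P n >] -> (n <= N)%N.
  by move=> /asboolP[e [oe _ e0]]; exact: bound oe e0.
case: (ex_maxnP exP ubP) => n /asboolP[e [[ee eo] e1 en0]] maxn.
exists n, e; split=> // i; split=> // f ff fe ef.
have [|f0] := pselect (f = 0); first by left.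
have [|fi] := pselect (f = e i); first by right.
exfalso.
(* Replacing [e i] by [f] and [e i - f] enlarges the family. *)
pose g m := if m == i then e i - f else e m.
have gg m : g m ∘ g m = g m.
  rewrite /g; case: eqP => // _.
  by rewrite mcompDl !mcompDr !compNm !compmN ee ff ef fe opprK addNr addr0.
have fg m : f ∘ g m = 0.
  rewrite /g; case: (eqVneq m i) => [_|mi].
    by rewrite mcompDr compmN fe ff subrr.
  by rewrite -fe -mcompA eo ?compm0 // eq_sym.
have gf m : g m ∘ f = 0.
  rewrite /g; case: (eqVneq m i) => [_|mi].
    by rewrite mcompDl compNm ef ff subrr.
  by rewrite -ef mcompA eo ?comp0m.
have g0 m l : m != l -> g m ∘ g l = 0.
  move=> ml; rewrite {2}/g; case: (eqVneq l i) => [li|li].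
    have mi : m != i by rewrite -li.
    by rewrite mcompDr compmN gf subr0 /g (negPf mi) eo.
  rewrite /g; case: (eqVneq m i) => [mi|mi]; last exact: eo.
  have il : i != l by rewrite eq_sym.
  by rewrite mcompDl compNm eo // -fe -mcompA eo // compm0 subr0.
pose e' (l : 'I_n.+1) := if unlift ord0 l is Some m then g m else f.
have /maxn : `[< P n.+1 >]; last by rewrite ltnn.
apply/asboolP; exists e'; split.
- split=> [l|l m]; rewrite /e'; first by case: unliftP => [?|] _.
  case: unliftP => [l'|] ->; case: unliftP => [m'|] -> //=.
    by rewrite (inj_eq lift_inj) => /g0.
- rewrite big_ord_recl /e' unlift_none.
  rewrite (eq_bigr g) => [|m _]; last by rewrite liftK.
  rewrite (bigD1 i) //= {1}/g eqxx addrA [f + _]addrC subrK -e1 [RHS](bigD1 i) //=.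
  by congr (_ + _); apply: eq_bigr => m mi; rewrite /g (negPf mi).
- move=> l; rewrite /e'; case: unliftP => [m|] _ //.
  rewrite /g; case: eqP => [_|_]; last exact: en0.
  by move/eqP; rewrite subr_eq0 => /eqP /esym.
Qed.

End Primitive.

(** * Biproducts of module functors *)

Section ActLemmas.
Variables (k : fieldType) (A : monCat k) (M : modCat A).

Lemma actMr (X : A) (m m' m'' : M) (g : hom m' m'') (f : hom m m') :
  (idm X ⊙₁ g) ∘ (idm X ⊙₁ f) = idm X ⊙₁ (g ∘ f).
Proof. by rewrite -actM mcomp1m. Qed.

Lemma act_sum (X : A) (m m' : M) (I : finType) (f : I -> hom m m') :
  idm X ⊙₁ (\sum_j f j) = \sum_j (idm X ⊙₁ f j).
Proof.
apply: (big_morph (fun h : hom m m' => idm X ⊙₁ h)) => [g h|].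
  exact: actD.
exact: act0.
Qed.

End ActLemmas.

(** Direct sums of module functors are computed objectwise in [N]; the
    constraint [sstr] is the direct sum of those of the summands, and it is
    invertible because the action preserves biproducts. All identities between
    morphisms out of a biproduct are checked on the inclusions. *)
Section BiprodFun.
Variables (k : fieldType) (A : monCat k) (M N : modCat A).
Hypothesis addN : additive_cat N.
Variables (n : nat) (F : 'I_n -> modFun M N).

Let B (m : M) := choose_biprod (fun j => F j m) addN.

Let sob (m : M) : N := B m.
Let smap (m m' : M) (f : hom m m') : hom (sob m) (sob m') :=
  copair (B m) (fun j => bp_in (B m') j ∘ fmap (F j) f).

Let smap_in (m m' : M) (f : hom m m') j :
  smap f ∘ bp_in (B m) j = bp_in (B m') j ∘ fmap (F j) f.
Proof. exact: copair_in. Qed.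

Fact bfun_lin m m' : linear (@smap m m').
Proof.
move=> a f g; apply: biprod_ext => j; rewrite compDZl !smap_in.
by rewrite fmap_lin compDZr.
Qed.

Fact bfun1 m : smap (idm m) = idm (sob m).
Proof. by apply: biprod_ext => j; rewrite smap_in fmap1 mcompm1 mcomp1m. Qed.

Fact bfunM m m' m'' (g : hom m' m'') (f : hom m m') :
  smap (g ∘ f) = smap g ∘ smap f.
Proof.
by apply: biprod_ext => j; rewrite -mcompA !smap_in mcompA smap_in -mcompA -fmapM.
Qed.

Definition bfun : linFun M N := LinFun bfun_lin bfun1 bfunM.

Let sstr (X : A) (m : M) : hom (sob (X ⊙ m)) (X ⊙ sob m) :=
  copair (B (X ⊙ m)) (fun j => (idm X ⊙₁ bp_in (B m) j) ∘ mstr (F j) X m).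

Let sstr_in X m j :
  sstr X m ∘ bp_in (B (X ⊙ m)) j = (idm X ⊙₁ bp_in (B m) j) ∘ mstr (F j) X m.
Proof. exact: copair_in. Qed.

Let sstrV (X : A) (m : M) : hom (X ⊙ sob m) (sob (X ⊙ m)) :=
  \sum_j (bp_in (B (X ⊙ m)) j ∘ iso_inv (mstr (F j) X m)
            ∘ (idm X ⊙₁ bp_pr (B m) j)).

Fact sstrK X m : sstrV X m ∘ sstr X m = idm (sob (X ⊙ m)).
Proof.
apply: biprod_ext => j; rewrite -mcompA sstr_in mcomp1m mcomp_suml (bigD1 j) //=.
rewrite big1 ?addr0 => [|l lj].
  rewrite -!mcompA [(idm X ⊙₁ _) ∘ (_ ∘ _)]mcompA actMr bp_prin act1 mcomp1m.
  by rewrite iso_homK mcompm1.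
rewrite -!mcompA [(idm X ⊙₁ _) ∘ (_ ∘ _)]mcompA actMr bp_prin0 // act0.
by rewrite comp0m !compm0.
Qed.

Fact sstrVK X m : sstr X m ∘ sstrV X m = idm (X ⊙ sob m).
Proof.
rewrite mcomp_sumr -act1 -[idm (sob m)](bp_sum (B m)) act_sum.
apply: eq_bigr => j _; rewrite !mcompA sstr_in.
by rewrite -[_ ∘ mstr _ _ _ ∘ _]mcompA iso_invK mcompm1 actMr.
Qed.

Let sstr_iso X m : iso (bfun (X ⊙ m)) (X ⊙ bfun m) :=
  Iso (sstrK X m) (sstrVK X m).

Fact bfun_nat (X X' : A) (m m' : M) (f : hom X X') (g : hom m m') :
  sstr_iso X' m' ∘ fmap bfun (f ⊙₁ g) = (f ⊙₁ fmap bfun g) ∘ sstr_iso X m.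
Proof.
apply: biprod_ext => j /=; rewrite -!mcompA smap_in sstr_in.
rewrite mcompA sstr_in -mcompA mstr_nat !mcompA -!actM.
by rewrite mcomp1m mcompm1 smap_in.
Qed.

Fact bfun_assoc (X Y : A) (m : M) :
  aassoc X Y (bfun m) ∘ sstr_iso (X ⊗ Y) m
  = (idm X ⊙₁ sstr_iso Y m) ∘ sstr_iso X (Y ⊙ m) ∘ fmap bfun (aassoc X Y m).
Proof.
apply: biprod_ext => j /=; rewrite -!mcompA smap_in sstr_in.
rewrite [LHS]mcompA -tens1 aassoc_nat -mcompA mstr_assoc.
rewrite [sstr X _ ∘ _]mcompA sstr_in !mcompA !actMr.
by rewrite sstr_in.
Qed.

Fact bfun_unit (m : M) :
  aunit (bfun m) ∘ sstr_iso tunit m = fmap bfun (aunit m).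
Proof.
apply: biprod_ext => j /=; rewrite smap_in -mcompA sstr_in mcompA aunit_nat.
by rewrite -mcompA mstr_unit.
Qed.

Definition bfun_mod : modFun M N := ModFun bfun_nat bfun_assoc bfun_unit.

Fact bin_nat j (m m' : M) (f : hom m m') :
  bp_in (B m') j ∘ fmap (F j) f = fmap bfun_mod f ∘ bp_in (B m) j.
Proof. by rewrite /= smap_in. Qed.

Fact bin_mod j (X : A) (m : M) :
  mstr bfun_mod X m ∘ bp_in (B (X ⊙ m)) j
  = (idm X ⊙₁ bp_in (B m) j) ∘ mstr (F j) X m.
Proof. exact: sstr_in. Qed.

Let bin j : modTrans (F j) bfun_mod :=
  @ModTrans k A M N (F j) bfun_mod (fun m => bp_in (B m) j) (bin_nat j) (bin_mod j).

Fact bpr_nat j (m m' : M) (f : hom m m') :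
  bp_pr (B m') j ∘ fmap bfun_mod f = fmap (F j) f ∘ bp_pr (B m) j.
Proof.
apply: biprod_ext => l; rewrite -!mcompA smap_in mcompA.
have [<-|jl] := eqVneq j l; first by rewrite !bp_prin mcomp1m mcompm1.
by rewrite !bp_prin0 // comp0m compm0.
Qed.

Fact bpr_mod j (X : A) (m : M) :
  mstr (F j) X m ∘ bp_pr (B (X ⊙ m)) j
  = (idm X ⊙₁ bp_pr (B m) j) ∘ mstr bfun_mod X m.
Proof.
apply: biprod_ext => l; rewrite -!mcompA sstr_in [in RHS]mcompA actMr.
have [<-|jl] := eqVneq j l; first by rewrite !bp_prin mcompm1 act1 mcomp1m.
by rewrite !bp_prin0 // act0 comp0m compm0.
Qed.

Let bpr j : modTrans bfun_mod (F j) :=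
  @ModTrans k A M N bfun_mod (F j) (fun m => bp_pr (B m) j) (bpr_nat j) (bpr_mod j).

Lemma mtrans_sumE (G H : modFun M N) (I : finType) (a : I -> modTrans G H) m :
  (\sum_i a i : modTrans G H) m = \sum_i a i m.
Proof. exact: (big_morph (fun t : modTrans G H => t m)). Qed.

Lemma modFun_biproduct : @is_biproduct (modFun_cat M N) n F bfun_mod.
Proof.
exists bin, bpr; split=> [j | j l jl |]; apply: mtransP => m.
- exact: bp_prin.
- exact: bp_prin0.
- by rewrite mtrans_sumE; exact: bp_sum.
Qed.

End BiprodFun.

Lemma modFun_additive (k : fieldType) (A : monCat k) (M N : modCat A) :
  additive_cat N -> additive_cat (modFun_cat M N).
Proof. by move=> addN n F; exists (bfun_mod addN F); exact: modFun_biproduct. Qed.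

Section HcompAdd.
Variables (k : fieldType) (A : monCat k) (M N P : modCat A).

Lemma hcompDl (G G' : modFun N P) (F : modFun M N) (b b' : modTrans G G') :
  hcomp (b + b') (mtrans_id F) = hcomp b (mtrans_id F) + hcomp b' (mtrans_id F).
Proof. by apply: mtransP => m; apply: mcompDl. Qed.

Lemma hcompDr (G : modFun N P) (F F' : modFun M N) (a a' : modTrans F F') :
  hcomp (mtrans_id G) (a + a') = hcomp (mtrans_id G) a + hcomp (mtrans_id G) a'.
Proof. by apply: mtransP => m; rewrite /= fmapD mcompDr. Qed.

End HcompAdd.

(** * Products of module categories *)

Section ProdMod.
Variables (k : fieldType) (A : monCat k) (n : nat) (F : 'I_n -> modCat A).

Let pl := prod_lin (fun j => F j : linCat k).
Let pact (X : A) (x : pl) : pl := fun j => X ⊙ x j.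
Let pactm (X X' : A) (x x' : pl) (f : hom X X') (g : hom x x') :
  hom (pact X x) (pact X' x') := fun j => f ⊙₁ g j.

Definition prodMod : modCat A.
Proof.
refine (@ModCat k A pl pact pactm _ _ _ _
  (fun X Y x => prod_iso (x := pact (X ⊗ Y) x) (y := pact X (pact Y x))
     (fun j => aassoc X Y (x j))) _
  (fun x => prod_iso (x := pact tunit x) (y := x) (fun j => aunit (x j))) _ _ _).
- by move=> X X' x x' g a f f'; apply: prod_homP => j; apply: act_linl.
- by move=> X X' x x' f a g g'; apply: prod_homP => j; apply: act_linr.
- by move=> X x; apply: prod_homP => j; apply: act1.
- by move=> X X' X'' x x' x'' f' f g' g; apply: prod_homP => j; apply: actM.
- by move=> X X' Y Y' x x' f g h; apply: prod_homP => j; apply: aassoc_nat.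
- by move=> x x' f; apply: prod_homP => j; apply: aunit_nat.
- by move=> X Y Z x; apply: prod_homP => j; apply: act_pentagon.
- by move=> X x; apply: prod_homP => j; apply: act_triangle.
Defined.

Lemma prodMod_finite : (forall j, finite_cat (F j)) -> finite_cat prodMod.
Proof. exact: prod_finite. Qed.

Definition proj_lin (l : 'I_n) : linFun prodMod (F l) :=
  @LinFun k prodMod (F l) (fun x => x l) (fun x y f => f l)
    (fun x y a f g => erefl) (fun x => erefl) (fun x y z g f => erefl).

Definition projMod (l : 'I_n) : modFun prodMod (F l).
Proof.
refine (@ModFun k A prodMod (F l) (proj_lin l) (fun X x => id_iso (X ⊙ x l)) _ _ _).
- by move=> X X' x x' f g; rewrite /= mcomp1m mcompm1.
- by move=> X Y x; rewrite /= act1 !mcomp1m mcompm1.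
- by move=> x; rewrite /= mcompm1.
Defined.

Section Tuple.
Variables (N : modCat A) (G : forall l, modFun N (F l)).

Definition tuple_lin : linFun N prodMod.
Proof.
refine (@LinFun k N prodMod (fun x l => G l x) (fun x y f l => fmap (G l) f) _ _ _).
- by move=> x y a f g; apply: prod_homP => l; apply: fmap_lin.
- by move=> x; apply: prod_homP => l; apply: fmap1.
- by move=> x y z g f; apply: prod_homP => l; apply: fmapM.
Defined.

Definition tupleMod : modFun N prodMod.
Proof.
refine (@ModFun k A N prodMod tuple_lin
  (fun X x => prod_iso (x := tuple_lin (X ⊙ x)) (y := pact X (tuple_lin x))
                (fun l => mstr (G l) X x)) _ _ _).
- by move=> X X' x x' f g; apply: prod_homP => l; apply: mstr_nat.
- by move=> X Y x; apply: prod_homP => l; apply: mstr_assoc.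
- by move=> x; apply: prod_homP => l; apply: mstr_unit.
Defined.

End Tuple.

Hypothesis addF : forall j, additive_cat (F j).

Definition zeroMod j l : modFun (F j) (F l) :=
  bfun_mod (@addF l) (fun i : 'I_0 => match notF (ltn_ord i) with end).

Lemma zeroMod_idm j l : idm (zeroMod j l : modFun_cat _ _) = 0.
Proof. exact: biprod0_idm (modFun_biproduct _ _). Qed.

(** The [l]-th coordinate of the inclusion of [F j] into the product: a Kronecker
    delta of module functors. As [F j] and [F l] are different types, the
    diagonal entries are transported along the equality of indices. *)
Definition kron j l : modFun (F j) (F l) :=
  match j =P l with
  | ReflectT e => eq_rect j (fun l => modFun (F j) (F l)) (id_modFun (F j)) l e
  | ReflectF _ => zeroMod j l
  end.

Lemma kronE j : kron j j = id_modFun (F j).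
Proof. by rewrite /kron; case: eqP => // e; rewrite (eq_irrelevance e erefl). Qed.

Lemma kron_zero j l : j != l -> idm (kron j l : modFun_cat _ _) = 0.
Proof. by rewrite /kron; case: eqP => // _ _; exact: zeroMod_idm. Qed.

Lemma kron_zero_at j l : j != l -> forall m, idm (kron j l m) = 0.
Proof.
move=> /kron_zero /(congr1 (fun t : modTrans _ _ => mtrans t)) h m.
by rewrite -[LHS]/((mtrans_id (kron j l)) m) h.
Qed.

(** These are the coordinates of the 2-cells [inc_proj] and [proj_inc], which
    exhibit the identity of the product as the direct sum of the composites
    [I_j P_j]. Stating them for arbitrary [j] and [l] confines the case analysis
    on [j = l], with its transports, to this lemma. *)
Lemma kron_trans j l :
  exists (u : modTrans (comp_modFun (kron j l) (projMod j)) (projMod l))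
         (v : modTrans (projMod l) (comp_modFun (kron j l) (projMod j))),
  [/\ forall x, v x ∘ u x = idm _,
      j = l -> forall x, u x ∘ v x = idm _
    & j != l -> (forall x, u x = 0) /\ (forall x, v x = 0)].
Proof.
have [<-|jl] := eqVneq j l.
  rewrite kronE; pose w := mod_unitl (projMod j).
  exists (iso_hom w), (iso_inv w).
  by split=> // [x | _ x]; rewrite /= mcomp1m.
exists 0, 0; split=> // [x | jl0]; last by rewrite jl0 eqxx in jl.
by rewrite [LHS]comp0m [RHS](kron_zero_at jl).
Qed.

Definition incMod j : modFun (F j) prodMod := tupleMod (kron j).

Let ku j l := sval (cid (kron_trans j l)).
Let kv j l := sval (cid (svalP (cid (kron_trans j l)))).
Let kuv j l := svalP (cid (svalP (cid (kron_trans j l)))).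

Definition inc_proj j :
  modTrans (comp_modFun (incMod j) (projMod j)) (id_modFun prodMod).
Proof.
apply: (@ModTrans k A _ _ (comp_modFun (incMod j) (projMod j)) (id_modFun prodMod)
   (fun x l => ku j l x)).
- by move=> x y f; apply: prod_homP => l; apply: (mtrans_nat (ku j l)).
- by move=> X x; apply: prod_homP => l; apply: (mtrans_mod (ku j l)).
Defined.

Definition proj_inc j :
  modTrans (id_modFun prodMod) (comp_modFun (incMod j) (projMod j)).
Proof.
apply: (@ModTrans k A _ _ (id_modFun prodMod) (comp_modFun (incMod j) (projMod j))
   (fun x l => kv j l x)).
- by move=> x y f; apply: prod_homP => l; apply: (mtrans_nat (kv j l)).
- by move=> X x; apply: prod_homP => l; apply: (mtrans_mod (kv j l)).
Defined.

Lemma proj_inc_id j :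
  isomorphic (C := modFun_cat _ _)
    (comp_modFun (projMod j) (incMod j)) (id_modFun (F j)).
Proof.
suff: isomorphic (C := modFun_cat _ _)
    (comp_modFun (projMod j) (incMod j)) (kron j j).
  by rewrite kronE.
set K := kron j j; set PI := comp_modFun _ _.
have modK X m :
    mstr K X m ∘ idm (K (X ⊙ m)) = (idm X ⊙₁ idm (K m)) ∘ mstr PI X m.
  by rewrite act1 /= !mcomp1m mcompm1.
have modPI X m :
    mstr PI X m ∘ idm (K (X ⊙ m)) = (idm X ⊙₁ idm (K m)) ∘ mstr K X m.
  by rewrite act1 /= !mcomp1m mcompm1.
split; apply: (mtrans_iso
  (a := @ModTrans k A _ _ PI K (fun m => idm (K m)) (mtrans_id_nat K) modK)
  (b := @ModTrans k A _ _ K PI (fun m => idm (K m)) (mtrans_id_nat K) modPI)).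
- by move=> m; exact: mcomp1m.
- by move=> m; exact: mcomp1m.
Qed.

Lemma prodMod_direct_sum : @is_direct_sum (modBicat A) n F prodMod.
Proof.
exists incMod, projMod; split.
- exact: proj_inc_id.
- move=> j l jl; apply: is_zeroP; apply: mtransP => m.
  by apply: (@kron_zero_at l j); rewrite eq_sym.
exists (id_modFun prodMod); last by split; exact: id_iso.
exists inc_proj, proj_inc; split=> [j | j l jl |]; apply: mtransP => x; apply: prod_homP => m.
- by case: (kuv j m) => h _ _; exact: h.
- have [lm|lm] := eqVneq l m; last first.
    case: (kuv l m) => _ _ /(_ lm) [/(_ x) u0 _].
    by rewrite -[LHS]/(kv j m x ∘ ku l m x) u0 compm0.
  rewrite lm in jl; case: (kuv j m) => _ _ /(_ jl) [_ /(_ x) v0].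
  by rewrite -[LHS]/(kv j m x ∘ ku l m x) v0 comp0m.
- rewrite mtrans_sumE prod_hom_sumE (bigD1 m) //= big1 ?addr0 => [|j jm].
    by case: (kuv m m) => _ /(_ erefl) h _; exact: h.
  by case: (kuv j m) => _ _ /(_ jm) [_ /(_ x) v0]; rewrite v0 compm0.
Qed.

(** The projection [P_j] has the inclusion [I_j] as right adjoint, hence
    preserves epimorphisms: to compare [g] and [h] after [e j], compare their
    adjuncts [I_j g] and [I_j h] after [e]. *)
Lemma proj_epi (x y : prodMod) (e : hom x y) j : epi e -> epi (e j).
Proof.
move=> epi_e z g h ge.
pose K l := kron j l.
have E : (fun l => fmap (K l) g ∘ kv j l y) = (fun l => fmap (K l) h ∘ kv j l y)
    :> hom y (incMod j z).
  apply: epi_e; apply: prod_homP => l.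
  rewrite -[LHS]/(fmap (K l) g ∘ kv j l y ∘ e l).
  rewrite -[RHS]/(fmap (K l) h ∘ kv j l y ∘ e l).
  have /= nat_v := mtrans_nat (kv j l) e.
  by rewrite -!mcompA nat_v !mcompA -!fmapM ge.
have Kgh : fmap (K j) g = fmap (K j) h.
  have /(congr1 (fun t => t ∘ ku j j y)) := congr1 (fun t : hom y (incMod j z) => t j) E.
  have [vu _ _] := kuv j j.
  by rewrite /= -!mcompA vu !mcompm1.
(* The type of [kron j j] is fixed by [g] and [h], so [kronE] is applied to a
   variable functor. *)
have Kid (G : modFun (F j) (F j)) : G = id_modFun (F j) -> fmap G g = fmap G h -> g = h.
  by move=> ->.
exact: Kid (kronE j) Kgh.
Qed.

Lemma prodMod_exact : (forall j, exact_mod (F j)) -> exact_mod prodMod.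
Proof.
move=> exF P x projP z y e epi_e f.
pose g j := cid (exF j P (x j) projP _ _ _ (proj_epi (j := j) epi_e) (f j)).
exists (fun j => sval (g j)); apply: prod_homP => j; exact: svalP (g j).
Qed.

End ProdMod.

(** * Blocks of a module category *)

Definition full_iso (k : fieldType) (C : linCat k) (T : Type) (phi : T -> C)
    (x y : full_lin phi) (u : iso (phi x) (phi y)) : iso x y :=
  @Iso (full_lin phi) x y (iso_hom u) (iso_inv u) (iso_homK u) (iso_invK u).

Lemma idempotent_at (k : fieldType) (A : monCat k) (M : modCat A)
    (e : modTrans (id_modFun M) (id_modFun M)) :
  vcomp e e = e -> forall m, e m ∘ e m = e m.
Proof. by move=> ee m; have /(congr1 (fun t : modTrans _ _ => t m)) := ee. Qed.

Section BlockMod.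
Variables (k : fieldType) (A : monCat k) (M : modCat A).
Variable e : modTrans (id_modFun M) (id_modFun M).
Hypothesis ee : vcomp e e = e.

Let eE := idempotent_at ee.

Lemma endo_act (X : A) (m : M) : e (X ⊙ m) = idm X ⊙₁ e m.
Proof. by have := mtrans_mod e X m; rewrite /= mcomp1m mcompm1. Qed.

Lemma endo_nat : natural_endo (fun m => e m).
Proof. by move=> m m' f; exact: (mtrans_nat e f). Qed.

Let Bl := block (fun m => e m).

Fact block_act_closed (X : A) (x : Bl) : e (X ⊙ sval x) = idm (X ⊙ sval x).
Proof. by rewrite endo_act (svalP x) act1. Qed.

Let bact (X : A) (x : Bl) : Bl := exist _ (X ⊙ sval x) (block_act_closed X x).

Definition blockMod : modCat A :=
  @ModCat k A Bl bact (fun X X' x x' f g => f ⊙₁ (g : hom (sval x) (sval x')))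
    (fun X X' x x' => @act_linl k A M X X' (sval x) (sval x'))
    (fun X X' x x' => @act_linr k A M X X' (sval x) (sval x'))
    (fun X x => @act1 k A M X (sval x))
    (fun X X' X'' x x' x'' => @actM k A M X X' X'' (sval x) (sval x') (sval x''))
    (fun X Y x => @full_iso k M _ _ (bact (X ⊗ Y) x) (bact X (bact Y x))
                    (aassoc X Y (sval x)))
    (fun X X' Y Y' x x' => @aassoc_nat k A M X X' Y Y' (sval x) (sval x'))
    (fun x => @full_iso k M _ _ (bact tunit x) x (aunit (sval x)))
    (fun x x' => @aunit_nat k A M (sval x) (sval x'))
    (fun X Y Z x => @act_pentagon k A M X Y Z (sval x))
    (fun X x => @act_triangle k A M X (sval x)).

Lemma blockMod_finite : finite_cat M -> finite_cat blockMod.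
Proof. exact: block_finite endo_nat eE. Qed.

Definition inclMod : modFun blockMod M.
Proof.
refine (@ModFun k A blockMod M (full_incl _) (fun X x => id_iso (X ⊙ sval x)) _ _ _).
- by move=> X X' x x' f g; rewrite /= mcomp1m mcompm1.
- by move=> X Y x; rewrite /= act1 !mcomp1m mcompm1.
- by move=> x; rewrite /= mcompm1.
Defined.

Variables (S : M -> M) (s_in : forall m, hom (S m) m) (s_pr : forall m, hom m (S m)).
Hypothesis prin : forall m, s_pr m ∘ s_in m = idm (S m).
Hypothesis inpr : forall m, s_in m ∘ s_pr m = e m.

Let pr_e m : s_pr m ∘ e m = s_pr m. Proof. by rewrite -inpr mcompA prin mcomp1m. Qed.
Let e_in m : e m ∘ s_in m = s_in m. Proof. by rewrite -inpr -mcompA prin mcompm1. Qed.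

Fact block_splitting m : e (S m) = idm (S m).
Proof.
by rewrite -[LHS]mcompm1 -prin mcompA endo_nat pr_e.
Qed.

Let sob (m : M) : blockMod := exist _ (S m) (block_splitting m).
Let smap m m' (f : hom m m') : hom (sob m) (sob m') := s_pr m' ∘ f ∘ s_in m.

Fact bproj_lin m m' : linear (@smap m m').
Proof. by move=> a f g; rewrite /smap compDZr compDZl. Qed.

Fact bproj1 m : smap (idm m) = idm (sob m).
Proof. by rewrite /smap mcompm1; exact: prin. Qed.

Fact bprojM m m' m'' (g : hom m' m'') (f : hom m m') :
  smap (g ∘ f) = smap g ∘ smap f.
Proof.
rewrite /smap -[RHS]/((s_pr m'' ∘ g ∘ s_in m') ∘ (s_pr m' ∘ f ∘ s_in m)).
rewrite -!mcompA [s_in m' ∘ _]mcompA inpr [e m' ∘ _]mcompA endo_nat.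
by rewrite -mcompA e_in.
Qed.

Definition bproj_linf : linFun M blockMod := LinFun bproj_lin bproj1 bprojM.

Fact pstrK (X : A) (m : M) :
  (s_pr (X ⊙ m) ∘ (idm X ⊙₁ s_in m)) ∘ ((idm X ⊙₁ s_pr m) ∘ s_in (X ⊙ m))
  = idm _.
Proof.
rewrite -mcompA [(idm X ⊙₁ _) ∘ (_ ∘ _)]mcompA actMr inpr -endo_act e_in.
exact: prin.
Qed.

Fact pstrVK (X : A) (m : M) :
  ((idm X ⊙₁ s_pr m) ∘ s_in (X ⊙ m)) ∘ (s_pr (X ⊙ m) ∘ (idm X ⊙₁ s_in m))
  = idm _.
Proof.
rewrite -mcompA [s_in _ ∘ _]mcompA inpr endo_act !actMr e_in prin.
exact: act1.
Qed.

Let pstr (X : A) (m : M) : iso (bproj_linf (X ⊙ m)) (X ⊙ bproj_linf m) :=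
  @full_iso k M _ _ (sob (X ⊙ m)) (bact X (sob m)) (Iso (pstrK X m) (pstrVK X m)).

(** The projection onto the block sends [m] to the image [S m] of [e m]. The
    action commutes with it because [e (X ⊙ m) = X ⊙ e m]. *)
Definition projBlock : modFun M blockMod.
Proof.
refine (@ModFun k A M blockMod bproj_linf pstr _ _ _).
(* Composition in [blockMod] is that of [M]: each goal is first restated as an
   equation in [M], where the identities between [s_in], [s_pr], [e] live. *)
- move=> X X' m m' f g.
  rewrite -[LHS]/(((idm X' ⊙₁ s_pr m') ∘ s_in (X' ⊙ m'))
                  ∘ (s_pr (X' ⊙ m') ∘ (f ⊙₁ g) ∘ s_in (X ⊙ m))).
  rewrite -[RHS]/((f ⊙₁ (s_pr m' ∘ g ∘ s_in m)) ∘ ((idm X ⊙₁ s_pr m) ∘ s_in (X ⊙ m))).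
  rewrite -!mcompA [s_in _ ∘ _]mcompA inpr endo_act.
  rewrite [(idm X' ⊙₁ _) ∘ (_ ∘ _)]mcompA actMr pr_e.
  rewrite !mcompA -!actM mcomp1m mcompm1 -!mcompA inpr.
  by rewrite -endo_nat mcompA pr_e.
- move=> X Y m.
  rewrite -[LHS]/(aassoc X Y (S m) ∘ ((idm (X ⊗ Y) ⊙₁ s_pr m) ∘ s_in ((X ⊗ Y) ⊙ m))).
  rewrite -[RHS]/((idm X ⊙₁ ((idm Y ⊙₁ s_pr m) ∘ s_in (Y ⊙ m)))
     ∘ ((idm X ⊙₁ s_pr (Y ⊙ m)) ∘ s_in (X ⊙ (Y ⊙ m)))
     ∘ (s_pr (X ⊙ (Y ⊙ m)) ∘ aassoc X Y m ∘ s_in ((X ⊗ Y) ⊙ m))).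
  rewrite [LHS]mcompA -tens1 aassoc_nat -!mcompA.
  rewrite [s_in _ ∘ (s_pr _ ∘ _)]mcompA inpr [e _ ∘ _]mcompA endo_nat -mcompA e_in.
  by rewrite [RHS]mcompA actMr -[_ ∘ s_in _ ∘ s_pr _]mcompA inpr endo_act actMr pr_e.
- move=> m.
  rewrite -[LHS]/(aunit (S m) ∘ ((idm tunit ⊙₁ s_pr m) ∘ s_in (tunit ⊙ m))).
  rewrite -[RHS]/(s_pr m ∘ aunit m ∘ s_in (tunit ⊙ m)).
  by rewrite mcompA aunit_nat.
Defined.

Lemma proj_incl_id :
  isomorphic (C := modFun_cat _ _) (comp_modFun projBlock inclMod) (id_modFun blockMod).
Proof.
set PI := comp_modFun _ _.
pose u (x : blockMod) : hom (PI x) x := s_in (sval x).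
pose v (x : blockMod) : hom x (PI x) := s_pr (sval x).
have u_nat (x y : blockMod) (f : hom x y) : u y ∘ fmap PI f = f ∘ u x.
  rewrite -[LHS]/(s_in (sval y) ∘ (s_pr (sval y) ∘ f ∘ s_in (sval x))).
  by rewrite -!mcompA mcompA inpr (svalP y) mcomp1m.
have v_nat (x y : blockMod) (f : hom x y) : v y ∘ f = fmap PI f ∘ v x.
  rewrite -[RHS]/(s_pr (sval y) ∘ f ∘ s_in (sval x) ∘ s_pr (sval x)).
  by rewrite -!mcompA inpr (svalP x) mcompm1.
have u_mod X (x : blockMod) :
    mstr (id_modFun blockMod) X x ∘ u (X ⊙ x) = (idm X ⊙₁ u x) ∘ mstr PI X x.
  rewrite -[LHS]/(idm (X ⊙ sval x) ∘ s_in (X ⊙ sval x)).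
  rewrite -[RHS]/((idm X ⊙₁ s_in (sval x)) ∘ ((idm X ⊙₁ s_pr (sval x))
     ∘ s_in (X ⊙ sval x) ∘ (s_pr (X ⊙ sval x) ∘ idm (X ⊙ sval x) ∘ s_in (X ⊙ sval x)))).
  rewrite mcomp1m mcompm1 -!mcompA prin mcompm1.
  by rewrite mcompA actMr inpr -endo_act e_in.
have v_mod X (x : blockMod) :
    mstr PI X x ∘ v (X ⊙ x) = (idm X ⊙₁ v x) ∘ mstr (id_modFun blockMod) X x.
  rewrite -[RHS]/((idm X ⊙₁ s_pr (sval x)) ∘ idm (X ⊙ sval x)).
  rewrite -[LHS]/(((idm X ⊙₁ s_pr (sval x))
     ∘ s_in (X ⊙ sval x) ∘ (s_pr (X ⊙ sval x) ∘ idm (X ⊙ sval x) ∘ s_in (X ⊙ sval x)))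
     ∘ s_pr (X ⊙ sval x)).
  rewrite !mcompm1 -!mcompA [s_pr _ ∘ (s_in _ ∘ _)]mcompA prin mcomp1m inpr.
  by rewrite endo_act actMr pr_e.
split; apply: (mtrans_iso (a := @ModTrans k A _ _ PI (id_modFun blockMod) u u_nat u_mod)
                   (b := @ModTrans k A _ _ (id_modFun blockMod) PI v v_nat v_mod)).
- by move=> x; exact: prin.
- by move=> x; exact: etrans (inpr _) (svalP x).
Qed.

Let IP := comp_modFun inclMod projBlock.

Lemma mstr_IP X m : iso_hom (mstr IP X m) = (idm X ⊙₁ s_pr m) ∘ s_in (X ⊙ m).
Proof. exact: mcomp1m. Qed.

Fact in_nat (m m' : M) (f : hom m m') :
  s_in m' ∘ fmap IP f = fmap (id_modFun M) f ∘ s_in m.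
Proof.
rewrite -[LHS]/(s_in m' ∘ (s_pr m' ∘ f ∘ s_in m)).
by rewrite -!mcompA mcompA inpr mcompA endo_nat -mcompA e_in.
Qed.

Fact in_mod (X : A) (m : M) :
  mstr (id_modFun M) X m ∘ s_in (X ⊙ m) = (idm X ⊙₁ s_in m) ∘ mstr IP X m.
Proof.
by rewrite mstr_IP mcompA actMr inpr -endo_act e_in; exact: mcomp1m.
Qed.

Definition in_trans : modTrans IP (id_modFun M) :=
  @ModTrans k A M M IP (id_modFun M) s_in in_nat in_mod.

Fact pr_nat (m m' : M) (f : hom m m') :
  s_pr m' ∘ fmap (id_modFun M) f = fmap IP f ∘ s_pr m.
Proof.
rewrite -[RHS]/(s_pr m' ∘ f ∘ s_in m ∘ s_pr m).
by rewrite -!mcompA inpr -endo_nat mcompA pr_e.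
Qed.

Fact pr_mod (X : A) (m : M) :
  mstr IP X m ∘ s_pr (X ⊙ m) = (idm X ⊙₁ s_pr m) ∘ mstr (id_modFun M) X m.
Proof.
by rewrite mstr_IP -mcompA inpr endo_act actMr pr_e; exact: esym (mcompm1 _).
Qed.

Definition pr_trans : modTrans (id_modFun M) IP :=
  @ModTrans k A M M (id_modFun M) IP s_pr pr_nat pr_mod.

(** Extension by zero identifies the 2-endomorphisms of the identity of the
    block with the corner [e End(id) e]; in this way primitivity of [e] becomes
    connectedness of the block. *)
Section Extend.
Variable t : modTrans (id_modFun blockMod) (id_modFun blockMod).

Let tt (m : M) : hom (S m) (S m) := t (sob m).

Let tt_nat m m' (g : hom (S m) (S m')) : tt m' ∘ g = g ∘ tt m.
Proof. exact: (mtrans_nat t (g : hom (sob m) (sob m'))). Qed.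

Let tt_act X m (g : hom (S (X ⊙ m)) (X ⊙ S m)) :
  (idm X ⊙₁ tt m) ∘ g = g ∘ tt (X ⊙ m).
Proof.
have -> : idm X ⊙₁ tt m = t (X ⊙ sob m).
  have := mtrans_mod t X (sob m).
  by rewrite [LHS]mcomp1m [RHS]mcompm1 => ->.
exact: (mtrans_nat t (g : hom (sob (X ⊙ m)) (X ⊙ sob m))).
Qed.

Let ext_fun (m : M) : hom m m := s_in m ∘ tt m ∘ s_pr m.

Fact ext_nat (m m' : M) (f : hom m m') : ext_fun m' ∘ f = f ∘ ext_fun m.
Proof.
rewrite /ext_fun -[s_pr m']pr_e -!mcompA endo_nat -inpr.
rewrite [tt m' ∘ _](_ : _ = (s_pr m' ∘ f ∘ s_in m) ∘ tt m ∘ s_pr m).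
  by rewrite !mcompA inpr endo_nat -[_ ∘ e m ∘ s_in m]mcompA e_in.
by rewrite -tt_nat !mcompA.
Qed.

Fact ext_mod (X : A) (m : M) :
  mstr (id_modFun M) X m ∘ ext_fun (X ⊙ m)
  = (idm X ⊙₁ ext_fun m) ∘ mstr (id_modFun M) X m.
Proof.
rewrite [LHS]mcomp1m [RHS]mcompm1 /ext_fun -!actMr.
have -> : idm X ⊙₁ s_pr m = (idm X ⊙₁ s_pr m) ∘ s_in (X ⊙ m) ∘ s_pr (X ⊙ m).
  by rewrite -mcompA inpr endo_act actMr pr_e.
rewrite [RHS]mcompA -[_ ∘ (idm X ⊙₁ tt m) ∘ _]mcompA tt_act !mcompA actMr inpr.
by rewrite -endo_act e_in.
Qed.

Definition ext_trans : modTrans (id_modFun M) (id_modFun M) :=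
  @ModTrans k A M M (id_modFun M) (id_modFun M) ext_fun ext_nat ext_mod.

End Extend.

Lemma ext_trans_block t (x : blockMod) : ext_trans t (sval x) = t x.
Proof.
have h : (t x : hom (sval x) (sval x)) ∘ s_in (sval x) = s_in (sval x) ∘ t (sob (sval x)).
  exact: (@mtrans_nat _ _ _ _ _ _ t (sob (sval x)) x (s_in (sval x))).
rewrite -[LHS]/(s_in (sval x) ∘ t (sob (sval x)) ∘ s_pr (sval x)).
by rewrite -h -mcompA inpr (svalP x) mcompm1.
Qed.

Lemma ext_trans_comp t t' : vcomp (ext_trans t) (ext_trans t') = ext_trans (vcomp t t').
Proof.
apply: mtransP => m.
rewrite -[LHS]/((s_in m ∘ t (sob m) ∘ s_pr m) ∘ (s_in m ∘ t' (sob m) ∘ s_pr m)).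
rewrite -[RHS]/(s_in m ∘ ((t (sob m) : hom (S m) (S m)) ∘ t' (sob m)) ∘ s_pr m).
by rewrite -!mcompA [s_pr m ∘ (_ ∘ _)]mcompA prin mcomp1m.
Qed.

Lemma ext_trans_endo t : vcomp (ext_trans t) e = ext_trans t.
Proof.
by apply: mtransP => m; rewrite /= -mcompA pr_e.
Qed.

Lemma endo_ext_trans t : vcomp e (ext_trans t) = ext_trans t.
Proof.
by apply: mtransP => m; rewrite /= !mcompA e_in.
Qed.

Lemma blockMod_idm0 : idm (id_modFun blockMod : modFun_cat _ _) = 0 -> e = 0.
Proof.
move=> id0; apply: mtransP => m.
rewrite -inpr -[s_in m]mcompm1.
have -> : idm (S m) = 0.
  by rewrite -[LHS]/((mtrans_id (id_modFun blockMod)) (sob m)) [mtrans_id _]id0.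
by rewrite compm0 comp0m.
Qed.

Lemma blockMod_idempotent :
  primitive (e : hom (id_modFun M : modFun_cat M M) (id_modFun M)) ->
  forall t : modTrans (id_modFun blockMod) (id_modFun blockMod), vcomp t t = t ->
  t = 0 \/ t = mtrans_id _.
Proof.
move=> [_ prim] t tt.
have [] := prim (ext_trans t).
- by rewrite -{3}tt -ext_trans_comp.
- exact: ext_trans_endo.
- exact: endo_ext_trans.
- move=> t0; left; apply: mtransP => x; by rewrite -ext_trans_block t0.
- move=> te; right; apply: mtransP => x.
  by rewrite -ext_trans_block te; exact: svalP x.
Qed.

(** Morphisms out of an object of the block land in the image of [e], so they can
    be tested inside the block. *)
Lemma block_epi (x y : blockMod) (f : hom x y) :
  epi f -> epi (f : @hom M (sval x) (sval y)).
Proof.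
move=> epi_f z g h gh.
have E : s_pr z ∘ g = s_pr z ∘ h.
  apply: (epi_f (sob z) (s_pr z ∘ g) (s_pr z ∘ h)).
  suff : s_pr z ∘ g ∘ f = s_pr z ∘ h ∘ f by [].
  by rewrite -!mcompA gh.
have ez (u : hom (sval y) z) : u = s_in z ∘ (s_pr z ∘ u).
  by rewrite mcompA inpr endo_nat (svalP y) mcompm1.
by rewrite [g]ez [h]ez E.
Qed.

Lemma blockMod_exact : exact_mod M -> exact_mod blockMod.
Proof.
move=> exM P x projP y z f epi_f g.
exact: (exM P (sval x) projP (sval y) (sval z) f (block_epi epi_f) g).
Qed.

End BlockMod.

Lemma zero_object_idm (B : bicategory) (X : B) : zero_object X -> idm (bid X) = 0.
Proof.
case=> F [i [p [_ _ [s /biprod0_idm s0 [u]]]]].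
exact: iso_idm0 u s0.
Qed.

Section Decompose.
Variables (k : fieldType) (A : monCat k) (M : modCat A).
Hypothesis splitM : idempotents_split M.

Section Family.
Variables (n : nat) (e : 'I_n -> modTrans (id_modFun M) (id_modFun M)).
Hypothesis ee : forall j, vcomp (e j) (e j) = e j.
Hypothesis e0 : forall j l, j != l -> vcomp (e j) (e l) = 0.
Hypothesis e1 : \sum_j e j = mtrans_id (id_modFun M).

Let eE j := idempotent_at (ee j).

Let S j m : splitting (e j m) := inhabited_witness (splitM (eE j m)).

Lemma blocks_direct_sum :
  @is_direct_sum (modBicat A) n (fun j => blockMod (e j)) M.
Proof.
pose prin j m := sp_prin (S j m).
pose inpr j m := sp_inpr (S j m).
exists (fun j => inclMod (e j)), (fun j => projBlock (prin j) (inpr j)); split.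
- move=> j; exact: proj_incl_id.
- move=> j l jl; apply: is_zeroP; apply: mtransP => x.
  rewrite -[LHS]/(idm (sp_ob (S j (sval x)))) -sp_prin -sp_pr_idem.
  rewrite -[sp_in _]mcomp1m -[idm (sval x)](svalP x).
  rewrite !mcompA -[_ ∘ e j _ ∘ _]mcompA.
  have /(congr1 (fun t : modTrans _ _ => t (sval x))) /= -> := e0 jl.
  by rewrite compm0 comp0m.
exists (id_modFun M); last by split; exact: id_iso.
exists (fun j => in_trans (prin j) (inpr j)), (fun j => pr_trans (prin j) (inpr j)).
split=> [j | j l jl |]; apply: mtransP => m.
- exact: prin.
- rewrite -[LHS]/(sp_pr (S j m) ∘ sp_in (S l m)) -sp_pr_idem -[sp_in _]sp_idem_in.
  rewrite !mcompA -[_ ∘ e j _ ∘ _]mcompA.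
  have /(congr1 (fun t : modTrans _ _ => t m)) /= -> := e0 jl.
  by rewrite compm0 comp0m.
- rewrite mtrans_sumE.
  have /(congr1 (fun t : modTrans _ _ => t m)) /= <- := e1.
  by rewrite mtrans_sumE; apply: eq_bigr => j _; exact: inpr.
Qed.

End Family.

Lemma blockMod_strongly_indecomposable
    (e : modTrans (id_modFun M) (id_modFun M)) : vcomp e e = e ->
  primitive (e : hom (id_modFun M : modFun_cat M M) (id_modFun M)) ->
  @strongly_indecomposable (modBicat A) (blockMod e).
Proof.
move=> ee prim.
have eE := idempotent_at ee.
pose S m := inhabited_witness (splitM (eE m)).
have id0 : idm (id_modFun (blockMod e) : modFun_cat _ _) <> 0.
  move=> /(blockMod_idm0 (fun m => sp_prin (S m)) (fun m => sp_inpr (S m))).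
  by case: prim.
split=> //; first by move=> /zero_object_idm.
exact: (blockMod_idempotent (fun m => sp_prin (S m)) (fun m => sp_inpr (S m)) prim).
Qed.

End Decompose.

(** * The Krull--Schmidt property *)

(** Full subbicategory along a map to the objects. A full subbicategory of a full
    subbicategory is convertible to one of this form, with [phi] the composite
    of the two projections, so that finite and exact module categories can be
    treated at once. *)
Definition full_along (B : bicategory) (T : Type) (phi : T -> B) : bicategory :=
  @Bicategory T (fun X Y => bhom (phi X) (phi Y))
    (fun X => bid (phi X))
    (fun X Y Z g f => g ⊚ f)
    (fun X Y Z g g' f f' b a => b ⊚₂ a)
    (fun X Y Z => @bcomp2_id B _ _ _)
    (fun X Y Z => @bcomp2_comp B _ _ _)
    (fun W X Y Z => @bassoc B _ _ _ _)
    (fun W X Y Z => @bassoc_nat B _ _ _ _)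
    (fun X Y => @bunitl B _ _)
    (fun X Y => @bunitl_nat B _ _)
    (fun X Y => @bunitr B _ _)
    (fun X Y => @bunitr_nat B _ _)
    (fun V W X Y Z => @bpentagon B _ _ _ _ _)
    (fun X Y Z => @btriangle B _ _ _).

Lemma full_along_direct_sum (B : bicategory) (T : Type) (phi : T -> B) n
    (F : 'I_n -> T) (G : 'I_n -> B) (t : T) :
  (forall j, phi (F j) = G j) -> is_direct_sum G (phi t) ->
  @is_direct_sum (full_along phi) n F t.
Proof.
move=> FG; have <- : (fun j => phi (F j)) = G by apply: functional_extensionality_dep.
exact: id.
Qed.

Lemma full_along_strongly_indecomposable (B : bicategory) (T : Type)
    (phi : T -> B) (t : T) (X : B) :
  phi t = X -> strongly_indecomposable X ->
  @strongly_indecomposable (full_along phi) t.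
Proof.
move=> <- [_ id0 idem]; split=> //.
by move=> /zero_object_idm.
Qed.

Lemma equivalent_refl (B : bicategory) (X : B) : equivalent X X.
Proof.
exists (bid X), (bid X); split; split; exact: bunitl.
Qed.

Section Main.
Variables (k : fieldType) (A : monCat k) (T : Type) (phi : T -> modBicat A).
Hypothesis fin_phi : forall t, finite_cat (phi t : modCat A).
Hypothesis prod_phi : forall n (F : 'I_n -> T),
  exists t, phi t = prodMod (fun j => phi (F j)).
Hypothesis block_phi : forall t (e : modTrans (id_modFun (phi t)) (id_modFun (phi t))),
  vcomp e e = e -> exists t', phi t' = blockMod e.

Let B := full_along phi.

Lemma additive_along : additive_bicat B.
Proof.
split=> [|n F].
  split=> [X Y | X Y Z g g' f b b' | X Y Z g f f' a a'].
  - by apply: modFun_additive; exact: finite_additive (fin_phi Y).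
  - exact: hcompDl.
  - exact: hcompDr.
have [t tP] := prod_phi F; exists t.
apply: (@full_along_direct_sum _ _ _ _ _ (fun j => phi (F j))) => //.
by rewrite tP; apply: prodMod_direct_sum => j; exact: finite_additive (fin_phi (F j)).
Qed.

(** The summands are the blocks cut out by a complete orthogonal family of
    primitive idempotents of the ring of 2-endomorphisms of the identity. *)
Lemma krull_schmidt_along : krull_schmidt B.
Proof.
split=> [|X _]; first exact: additive_along.
have splM := finite_split (fin_phi X).
have [N bound] := orthogonal_natural_bound (fin_phi X).
have [|n [e [[ee e0] e1 prim]]] :=
  @primitive_decomposition (modFun_cat (phi X) (phi X)) (id_modFun (phi X)) N.
  move=> n e [ee e0] en0; apply: (bound n (fun i x => (e i : modTrans _ _) x)).
  - by move=> i; exact: endo_nat.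
  - by move=> i x; have /(congr1 (fun t : modTrans _ _ => t x)) := ee i.
  - move=> i j ij x.
    by have /(congr1 (fun t : modTrans _ _ => t x)) := e0 i j ij.
  - move=> i; apply: contrapT => nex; apply: (en0 i); apply: mtransP => x.
    by apply: contrapT => ex; apply: nex; exists x.
pose F j := sval (cid (block_phi (ee j))).
have FE j : phi (F j) = blockMod (e j) := svalP (cid (block_phi (ee j))).
exists n, F, X; split; last exact: equivalent_refl.
- move=> j; apply: full_along_strongly_indecomposable (FE j) _.
  exact: (blockMod_strongly_indecomposable splM (ee j) (prim j)).
- apply: full_along_direct_sum FE _.
  exact: (blocks_direct_sum splM ee e0 e1).
Qed.

End Main.

Theorem corollary7p18 (k : closedFieldType) (A : monCat k)
    (hA : finite_multitensor A) :
  krull_schmidt (finModBicat A) /\ krull_schmidt (exactModBicat A).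
Proof.
pose fin (M : modCat A) : Prop := finite_cat M.
pose ex (M : {M : modCat A | fin M}) := exact_mod (sval M).
split.
- apply: (@krull_schmidt_along k A {M : modCat A | finite_cat M} sval).
  + exact: svalP.
  + by move=> n F; exists (exist fin _ (prodMod_finite (fun j => svalP (F j)))).
  + by move=> M e ee; exists (exist fin _ (blockMod_finite ee (svalP M))).
- apply: (@krull_schmidt_along k A
    {M : {M : modCat A | finite_cat M} | exact_mod (sval M)} (fun M => sval (sval M))).
  + by move=> M; exact: svalP (sval M).
  + move=> n F.
    have exP : exact_mod (prodMod (fun j => sval (sval (F j)))).
      apply: prodMod_exact => j; last exact: svalP (F j).
      exact: finite_additive (svalP (sval (F j))).
    by exists (exist ex (exist fin _ (prodMod_finite (fun j => svalP (sval (F j))))) exP).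
  + move=> M e ee.
    have exB : exact_mod (blockMod e).
      have splM := finite_split (svalP (sval M)).
      pose S m := inhabited_witness (splM m (e m) (idempotent_at ee m)).
      exact: (blockMod_exact (fun m => sp_prin (S m)) (fun m => sp_inpr (S m)) (svalP M)).
    by exists (exist ex (exist fin _ (blockMod_finite ee (svalP (sval M)))) exB).
Qed.
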